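(* (In $\mathbf{ZF}$.) (i) The negation of $\mathbf{CAC}_{\omega}(\mathbb{R})$ implies that there exists a subspace $\mathbf{X}$ of $\mathbb{R}$ such that $\mathbf{X}$ is neither a $k$-space nor Loeb, but every uncountable subset of $X$ contains an infinite closed subset of $\mathbf{X}$. (ii) If every subspace of $\mathbb{R}$ is either a $k$-space or Loeb, then $\mathbf{CAC}(\mathbb{R})$ holds.
   Context: The result is a theorem of $\mathbf{ZF}$ (Zermelo–Fraenkel set theory without the axiom of choice). A set is countable if it is equipotent with a subset of $\omega$, uncountable otherwise, and denumerable if it is countable and infinite. $\mathbf{CAC}(\mathbb{R})$: every denumerable family of non-empty subsets of $\mathbb{R}$ has a choice function. $\mathbf{CAC}_{\omega}(\mathbb{R})$: every denumerable family of countable non-empty subsets of $\mathbb{R}$ has a choice function. A topological space is Loeb if the family of all its non-empty closed subsets has a choice function. A space $\mathbf{X}$ is a $k$-space if it is Hausdorff and every set $A\subseteq X$, such that $A\cap K$ is closed in $\mathbf{X}$ for every compact $K\subseteq X$, is closed in $\mathbf{X}$. $\mathbb{R}$ carries its standard topology. *)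

(* Defs.v *)
(* A statement "provable in ZF" is rendered as a statement about an arbitrary
   model V of first-order ZF, all of whose set-theoretic notions (functions,
   families, countability, choice functions, topologies, the reals) are
   interpreted by elements of V.  By soundness and completeness of first-order
   logic, this is the same as provability in ZF.  In particular no choice
   principle of the metatheory is available inside V, because separation and
   replacement are only assumed for first-order formulas with parameters. *)

Set Implicit Arguments.
Unset Strict Implicit.
Unset Printing Implicit Defensive.

Record set_structure : Type := SetStructure {
  carrier :> Type;
  mem : carrier -> carrier -> Prop
}.

Declare Scope zf_scope.
Notation "x ∈ a" := (mem x a) (at level 70, no associativity) : zf_scope.
Open Scope zf_scope.

(* First-order formulas of the language {∈, =}, with de Bruijn indices. *)
Inductive formula : Type :=
| FMem (i j : nat)
| FEq (i j : nat)
| FBot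
| FAnd (p q : formula)
| FOr (p q : formula)
| FImp (p q : formula)
| FAll (p : formula)
| FEx (p : formula).

Definition scons (T : Type) (x : T) (e : nat -> T) : nat -> T :=
  fun n => match n with O => x | S m => e m end.

Fixpoint sat (V : set_structure) (e : nat -> V) (p : formula) : Prop :=
  match p with
  | FMem i j => e i ∈ e j
  | FEq i j => e i = e j
  | FBot => False
  | FAnd q r => sat e q /\ sat e r
  | FOr q r => sat e q \/ sat e r
  | FImp q r => sat e q -> sat e r
  | FAll q => forall x : V, sat (scons x e) q
  | FEx q => exists x : V, sat (scons x e) q
  end.

Section Notions.
Variable V : set_structure.
Implicit Types a b c f p s t u w x y z : V.

Definition subset a b : Prop := forall x, x ∈ a -> x ∈ b.
Definition nonempty a : Prop := exists x, x ∈ a.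
Definition is_empty a : Prop := forall x, ~ x ∈ a.
Definition is_upair p x y : Prop := forall t, t ∈ p <-> t = x \/ t = y.
Definition is_union u a : Prop := forall x, x ∈ u <-> exists y, y ∈ a /\ x ∈ y.
Definition is_power p a : Prop := forall x, x ∈ p <-> subset x a.
Definition is_inter c a b : Prop := forall x, x ∈ c <-> x ∈ a /\ x ∈ b.
Definition is_diff c a b : Prop := forall x, x ∈ c <-> x ∈ a /\ ~ x ∈ b.
Definition is_succ s x : Prop := forall t, t ∈ s <-> t ∈ x \/ t = x.
Definition inductive w : Prop :=
  (exists e, is_empty e /\ e ∈ w) /\
  (forall x, x ∈ w -> exists s, is_succ s x /\ s ∈ w).

Record ZF : Prop := {
  zf_extensionality : forall a b, (forall x, x ∈ a <-> x ∈ b) -> a = b;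
  zf_foundation : forall a, nonempty a ->
    exists x, x ∈ a /\ forall y, y ∈ a -> ~ y ∈ x;
  zf_pairing : forall x y, exists p, is_upair p x y;
  zf_union : forall a, exists u, is_union u a;
  zf_power : forall a, exists p, is_power p a;
  zf_infinity : exists w, inductive w;
  zf_separation : forall (phi : formula) (e : nat -> V) a,
    exists b, forall x, x ∈ b <-> x ∈ a /\ sat (scons x e) phi;
  zf_replacement : forall (phi : formula) (e : nat -> V) a,
    (forall x y z, x ∈ a ->
       sat (scons y (scons x e)) phi -> sat (scons z (scons x e)) phi ->
       y = z) ->
    exists b, forall y,
      y ∈ b <-> exists x, x ∈ a /\ sat (scons y (scons x e)) phi
}.

(* Kuratowski pairs: p = {{x}, {x, y}}. *)
Definition is_opair p x y : Prop :=
  forall t, t ∈ p <-> is_upair t x x \/ is_upair t x y.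

(* (x, y) ∈ f; when f is a function, f(x) = y. *)
Definition rel f x y : Prop := exists p, is_opair p x y /\ p ∈ f.

Definition is_product c a b : Prop :=
  forall p, p ∈ c <-> exists x y, x ∈ a /\ y ∈ b /\ is_opair p x y.

Definition is_function f a b : Prop :=
  (forall p, p ∈ f -> exists x y, x ∈ a /\ y ∈ b /\ is_opair p x y) /\
  (forall x, x ∈ a -> exists! y, rel f x y).

Definition is_bijection f a b : Prop :=
  is_function f a b /\
  (forall x x' y, rel f x y -> rel f x' y -> x = x') /\
  (forall y, y ∈ b -> exists x, rel f x y).

Definition equipotent a b : Prop := exists f, is_bijection f a b.

Definition is_omega w : Prop :=
  inductive w /\ forall a, inductive a -> subset w a.

Definition finite a : Prop :=
  exists w n, is_omega w /\ n ∈ w /\ equipotent a n.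
Definition infinite a : Prop := ~ finite a.
Definition countable a : Prop :=
  exists w b, is_omega w /\ subset b w /\ equipotent a b.
Definition uncountable a : Prop := ~ countable a.
Definition denumerable a : Prop := countable a /\ infinite a.

Definition is_choice_function f (F : V) : Prop :=
  exists u, is_function f F u /\
    forall a y, a ∈ F -> rel f a y -> y ∈ a.

Definition has_choice_function (F : V) : Prop :=
  exists f, is_choice_function f F.

Definition CAC (R : V) : Prop := forall F : V,
  denumerable F ->
  (forall a, a ∈ F -> subset a R /\ nonempty a) ->
  has_choice_function F.

Definition CAC_omega (R : V) : Prop := forall F : V,
  denumerable F ->
  (forall a, a ∈ F -> subset a R /\ nonempty a /\ countable a) ->
  has_choice_function F.

(* In the topological notions, T is the set of open subsets of X. *)

Definition closed_in (X T C : V) : Prop :=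
  subset C X /\ exists O, O ∈ T /\ is_diff O X C.

Definition hausdorff (X T : V) : Prop :=
  forall x y, x ∈ X -> y ∈ X -> x <> y ->
  exists O O', O ∈ T /\ O' ∈ T /\ x ∈ O /\ y ∈ O' /\
    forall z, ~ (z ∈ O /\ z ∈ O').

Definition covers (U K : V) : Prop :=
  forall x, x ∈ K -> exists O, O ∈ U /\ x ∈ O.

Definition compact_in (X T K : V) : Prop :=
  subset K X /\
  forall U : V, subset U T -> covers U K ->
  exists W : V, subset W U /\ finite W /\ covers W K.

Definition k_space (X T : V) : Prop :=
  hausdorff X T /\
  forall A : V, subset A X ->
    (forall K I : V, compact_in X T K -> is_inter I A K -> closed_in X T I) ->
    closed_in X T A.

Definition loeb (X T : V) : Prop :=
  exists F : V,
    (forall C, C ∈ F <-> closed_in X T C /\ nonempty C) /\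
    has_choice_function F.

(* T is the subspace topology on X induced by the topology TR. *)
Definition is_subspace_topology (TR X T : V) : Prop :=
  forall O, O ∈ T <-> exists U, U ∈ TR /\ is_inter O U X.

(* o(x, y) = z for a binary operation o. *)
Definition op o x y z : Prop := exists p, is_opair p x y /\ rel o p z.

Definition is_binop o (R : V) : Prop :=
  exists P, is_product P R R /\ is_function o P R.

(* (R, add, mul, zero, one, lt) is, in the sense of V, a Dedekind complete
   ordered field; ZF proves that there is one, unique up to isomorphism. *)
Record is_reals (R zero one add mul lt : V) : Prop := {
  reals_zero : zero ∈ R;
  reals_one : one ∈ R;
  reals_add : is_binop add R;
  reals_mul : is_binop mul R;
  reals_addA : forall x y z xy yz s, op add x y xy -> op add y z yz ->
    op add xy z s -> op add x yz s;
  reals_addC : forall x y s, op add x y s -> op add y x s;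
  reals_add0 : forall x, x ∈ R -> op add x zero x;
  reals_addN : forall x, x ∈ R -> exists y, op add x y zero;
  reals_mulA : forall x y z xy yz s, op mul x y xy -> op mul y z yz ->
    op mul xy z s -> op mul x yz s;
  reals_mulC : forall x y s, op mul x y s -> op mul y x s;
  reals_mul1 : forall x, x ∈ R -> op mul x one x;
  reals_mulV : forall x, x ∈ R -> x <> zero -> exists y, op mul x y one;
  reals_mulD : forall x y z yz xy xz s, op add y z yz -> op mul x y xy ->
    op mul x z xz -> op mul x yz s -> op add xy xz s;
  reals_01 : zero <> one;
  reals_lt : forall p, p ∈ lt -> exists x y, x ∈ R /\ y ∈ R /\ is_opair p x y;
  reals_lt_irrefl : forall x, ~ rel lt x x;
  reals_lt_trans : forall x y z, rel lt x y -> rel lt y z -> rel lt x z;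
  reals_lt_total : forall x y, x ∈ R -> y ∈ R ->
    rel lt x y \/ x = y \/ rel lt y x;
  reals_lt_add : forall x y z xz yz, rel lt x y ->
    op add x z xz -> op add y z yz -> rel lt xz yz;
  reals_lt_mul : forall x y s, rel lt zero x -> rel lt zero y ->
    op mul x y s -> rel lt zero s;
  reals_sup : forall a, subset a R -> nonempty a ->
    (exists b, b ∈ R /\ forall x, x ∈ a -> ~ rel lt b x) ->
    exists b, b ∈ R /\ (forall x, x ∈ a -> ~ rel lt b x) /\
      forall c, c ∈ R -> (forall x, x ∈ a -> ~ rel lt c x) -> ~ rel lt c b
}.

(* TR is the set of open subsets of R, i.e. of unions of open intervals. *)
Definition is_standard_topology (R lt TR : V) : Prop :=
  forall O, O ∈ TR <->
    subset O R /\
    forall x, x ∈ O -> exists a b, rel lt a x /\ rel lt x b /\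
      forall y, rel lt a y -> rel lt y b -> y ∈ O.

End Notions.

(* Main.v *)
From HB Require Import structures.
From mathcomp Require Import all_boot all_order all_algebra.
From mathcomp Require Import boolp.
From mathcomp Require Import ring lra.
Require Import Defs.

Set Implicit Arguments.
Unset Strict Implicit.
Unset Printing Implicit Defensive.

(** Given a countable family of non-empty sets of reals without choice
    function, index it by the natural numbers as [A 0, A 1, ...], padding with
    [{0}]. Choices from finitely many sets exist, and a finite sequence of reals
    can be encoded by one real: the Dedekind cuts of its terms form a set of
    natural numbers ([digits]), and a set [D] of natural numbers is encoded by
    the sum of the [3 ^- n] for [n] in [D] ([digit_sums]); see [code_inj]. Let
    [block n] be the set of the codes of the elements of
    [A 0 * ... * A (n - 1)], shifted and scaled by [weight n = 3 ^- n] into the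
    closed interval from [weight n] to [5/2 * weight n]. These intervals are
    disjoint and tend to 0. Choosing from infinitely many blocks amounts to
    choosing from all the [A n] ([partial_choice]), which is impossible.

    The space [X] consists of 0 and of all the blocks.
    - Each block is closed in [X], so [X] is not Loeb ([space_not_loeb]).
    - A compact subset of [X] has a least element in each block that it meets,
      so that it meets only boundedly many blocks. Hence [X \ {0}], which is not
      closed, has a closed intersection with each compact set
      ([space_not_k]).
    - If the [A n] are countable, then so are the blocks. Let [U] be a subset of
      [X] without infinite closed subset. When [U] meets [block n], the infimum
      of this intersection belongs to [block n]: otherwise the left-to-right
      minima of an enumeration of the intersection would form an infinite closed
      set ([infinite_closed_ex]). As these infima cannot be chosen infinitely
      often, [U] meets boundedly many blocks, and it is countable
      ([uncountable_infinite_closed]).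

    The first two items, for a family of arbitrary sets of reals, give (ii); all
    three, for a family of countable sets, give (i).

    Inside a model of ZF, separation is available for first-order formulas only.
    Predicates on the model are therefore accompanied by proofs that they are
    [definable], which the tactic [defn] finds by following their syntax. The
    reals of the model are turned into a [realFieldType] [K] with an embedding
    [v : K -> V] ([reals_model_ex]), so that computations with them can be
    carried out in [K]; the set [naturals] of the model, the least one that
    contains 0 and is closed under adding 1, provides induction and recursion. *)

(** * Definable predicates *)

(** The axioms of ZF are found by type class inference. *)
Existing Class ZF.

Section Definability.
Variable V : set_structure.
Implicit Types (e c : nat -> V).

(** Renaming of the free variables of a formula. *)
Fixpoint rename (r : nat -> nat) (p : formula) : formula :=
  match p with
  | FMem i j => FMem (r i) (r j)
  | FEq i j => FEq (r i) (r j)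
  | FBot => FBot
  | FAnd p q => FAnd (rename r p) (rename r q)
  | FOr p q => FOr (rename r p) (rename r q)
  | FImp p q => FImp (rename r p) (rename r q)
  | FAll p => FAll (rename (fun n => if n is m.+1 then (r m).+1 else 0) p)
  | FEx p => FEx (rename (fun n => if n is m.+1 then (r m).+1 else 0) p)
  end.

Lemma sat_rename p : forall r (e e' : nat -> V),
  (forall n, e' n = e (r n)) -> sat e (rename r p) <-> sat e' p.
Proof.
elim: p => [i j|i j||p IHp q IHq|p IHp q IHq|p IHp q IHq|p IHp|p IHp] r e e' E /=.
- by rewrite !E.
- by rewrite !E.
- by [].
- by rewrite (IHp _ _ _ E) (IHq _ _ _ E).
- by rewrite (IHp _ _ _ E) (IHq _ _ _ E).
- by rewrite (IHp _ _ _ E) (IHq _ _ _ E).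
- have H x : sat (scons x e) (rename (fun n => if n is m.+1 then (r m).+1 else 0) p)
     <-> sat (scons x e') p by apply: IHp; case.
  by split=> h x; apply/H.
- have H x : sat (scons x e) (rename (fun n => if n is m.+1 then (r m).+1 else 0) p)
     <-> sat (scons x e') p by apply: IHp; case.
  by split=> -[x h]; exists x; apply/H.
Qed.

(** The environment that lists the entries of [e] at even indices and those of
    [c] at odd indices. *)
Fixpoint mix e c (n : nat) : V :=
  match n with
  | 0 => e 0
  | 1 => c 0
  | n.+2 => mix (fun n => e n.+1) (fun n => c n.+1) n
  end.

Lemma mix_even n e c : mix e c n.*2 = e n.
Proof. by elim: n e c => // n IH e c; rewrite doubleS /= IH. Qed.

Lemma mix_odd n e c : mix e c n.*2.+1 = c n.
Proof. by elim: n e c => // n IH e c; rewrite doubleS; apply: IH. Qed.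

Lemma mix_rec (f : nat -> V) e c :
  (forall n, f n.*2 = e n) -> (forall n, f n.*2.+1 = c n) ->
  forall n, f n = mix e c n.
Proof.
move=> he hc n; rewrite -(odd_double_half n).
by case: (odd n); rewrite ?add1n ?add0n ?hc ?he ?mix_odd ?mix_even.
Qed.

Let odd_double1 n : odd n.*2.+1 = true. Proof. by rewrite /= odd_double. Qed.

Let half_double1 n : n.*2.+1./2 = n.
Proof. by rewrite -[n.*2.+1]/(true + n.*2) half_bit_double. Qed.

(** [P] is expressed by a first-order formula with parameters: the odd variables
    of the formula are used for the parameters, the even ones for the
    environment. *)
Definition definable (P : (nat -> V) -> Prop) : Prop :=
  exists phi c, forall e, sat (mix e c) phi <-> P e.

(** Two lists [c] and [d] of parameters are merged into [mix c d]; [evens] and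
    [odds] redirect the variables of formulas with parameters [c] and [d]. *)
Definition evens (r : nat -> nat) (n : nat) : nat :=
  if odd n then n./2.*2.*2.+1 else (r n./2).*2.

Definition odds (r : nat -> nat) (n : nat) : nat :=
  if odd n then n./2.*2.+1.*2.+1 else (r n./2).*2.

Lemma definable_mix2 P Q : definable P -> definable Q ->
  exists phi psi c, forall e, (sat (mix e c) phi <-> P e) /\
                              (sat (mix e c) psi <-> Q e).
Proof.
move=> [phi [c hP]] [psi [d hQ]].
exists (rename (evens id) phi), (rename (odds id) psi), (mix c d) => e; split.
- rewrite -hP; apply: sat_rename => n; symmetry; move: n; apply: mix_rec => n.
  + by rewrite /evens odd_double doubleK mix_even.
  + by rewrite /evens odd_double1 half_double1 mix_odd mix_even.
- rewrite -hQ; apply: sat_rename => n; symmetry; move: n; apply: mix_rec => n.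
  + by rewrite /odds odd_double doubleK mix_even.
  + by rewrite /odds odd_double1 half_double1 !mix_odd.
Qed.

Lemma definable_ext P Q : (forall e, P e <-> Q e) -> definable P -> definable Q.
Proof. by move=> h [phi [c hP]]; exists phi, c => e; rewrite hP. Qed.

Lemma definable_and P Q :
  definable P -> definable Q -> definable (fun e => P e /\ Q e).
Proof.
move=> dP dQ; have [phi [psi [c h]]] := definable_mix2 dP dQ.
by exists (FAnd phi psi), c => e /=; rewrite (proj1 (h e)) (proj2 (h e)).
Qed.

Lemma definable_or P Q :
  definable P -> definable Q -> definable (fun e => P e \/ Q e).
Proof.
move=> dP dQ; have [phi [psi [c h]]] := definable_mix2 dP dQ.
by exists (FOr phi psi), c => e /=; rewrite (proj1 (h e)) (proj2 (h e)).
Qed.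

Lemma definable_imp P Q :
  definable P -> definable Q -> definable (fun e => P e -> Q e).
Proof.
move=> dP dQ; have [phi [psi [c h]]] := definable_mix2 dP dQ.
by exists (FImp phi psi), c => e /=; rewrite (proj1 (h e)) (proj2 (h e)).
Qed.

Lemma definable_iff P Q :
  definable P -> definable Q -> definable (fun e => P e <-> Q e).
Proof. by move=> dP dQ; apply: definable_and; apply: definable_imp. Qed.


Lemma definable_not P : definable P -> definable (fun e => ~ P e).
Proof.
move=> [phi [c hP]]; exists (FImp phi FBot), c => e /=.
by split=> h k; apply/h/hP.
Qed.

(** Pushing a value on [mix e c] instead of [e] renumbers the variables. *)
Let bind (n : nat) : nat :=
  if odd n then n.+1 else if n is 0 then 0 else n.-1.

Lemma mix_bind x e c n : mix (scons x e) c n = scons x (mix e c) (bind n).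
Proof.
symmetry; move: n; apply: mix_rec => n.
- by case: n => [|n] //; rewrite /bind odd_double doubleS /= mix_even.
- by rewrite /bind odd_double1; apply: mix_odd.
Qed.

Lemma definable_all (P : (nat -> V) -> V -> Prop) :
  definable (fun e => P (fun n => e n.+1) (e 0)) ->
  definable (fun e => forall x, P e x).
Proof.
move=> [phi [c hP]]; exists (FAll (rename bind phi)), c => e /=.
have H x : sat (scons x (mix e c)) (rename bind phi) <-> P e x.
  by rewrite (sat_rename _ (mix_bind x e c)) hP.
by split=> h x; apply/H.
Qed.

Lemma definable_ex (P : (nat -> V) -> V -> Prop) :
  definable (fun e => P (fun n => e n.+1) (e 0)) ->
  definable (fun e => exists x, P e x).
Proof.
move=> [phi [c hP]]; exists (FEx (rename bind phi)), c => e /=.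
have H x : sat (scons x (mix e c)) (rename bind phi) <-> P e x.
  by rewrite (sat_rename _ (mix_bind x e c)) hP.
by split=> -[x h]; exists x; apply/H.
Qed.

(** A term, i.e. a map from environments to [V], is definable if its graph
    is. *)
Definition dterm (t : (nat -> V) -> V) : Prop :=
  definable (fun e => e 0 = t (fun n => e n.+1)).

Lemma dterm_const a : dterm (fun=> a).
Proof.
exists (FEq 0 1), (fun=> a) => e.
by [].
Qed.

Context {hV : ZF V}.

Lemma ZF_inhabited : exists x : V, True.
Proof. by have [w _] := zf_infinity hV; exists w. Qed.

Lemma dterm_var n : dterm (fun e => e n).
Proof.
have [x _] := ZF_inhabited; exists (FEq 0 n.+1.*2), (fun=> x) => e.
change (mix e (fun=> x) 0 = mix e (fun=> x) n.+1.*2 <-> e 0 = e n.+1).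
by rewrite mix_even.
Qed.

Lemma definable_mem_var i j : definable (fun e => mem (e i) (e j)).
Proof.
have [x _] := ZF_inhabited; exists (FMem i.*2 j.*2), (fun=> x) => e.
by rewrite /sat !mix_even.
Qed.

Lemma definable_eq_var i j : definable (fun e => e i = e j).
Proof.
have [x _] := ZF_inhabited; exists (FEq i.*2 j.*2), (fun=> x) => e.
by rewrite /sat !mix_even.
Qed.

Lemma definable_rename r P : definable P -> definable (fun e => P (fun n => e (r n))).
Proof.
move=> [phi [c hP]].
exists (rename (fun n => if odd n then n else (r n./2).*2) phi), c => e.
rewrite -hP; apply: sat_rename => n; symmetry; move: n; apply: mix_rec => n.
- by rewrite odd_double doubleK mix_even.
- by rewrite odd_double1 mix_odd.
Qed.

Lemma definable_subst (P : (nat -> V) -> V -> Prop) t :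
  definable (fun e => P (fun n => e n.+1) (e 0)) -> dterm t ->
  definable (fun e => P e (t e)).
Proof.
move=> dP dt; apply: (@definable_ext (fun e => exists x, x = t e /\ P e x)).
  by move=> e; split=> [[x [-> //]]|h]; exists (t e).
by apply: definable_ex; apply: definable_and.
Qed.

Lemma dterm_rename r t : dterm t -> dterm (fun e => t (fun n => e (r n))).
Proof.
exact: (definable_rename (fun n => if n is m.+1 then (r m).+1 else 0)).
Qed.

(** Definability for predicates given by their arguments, rather than by an
    environment. *)
Definition definable1 (P : V -> Prop) := definable (fun e => P (e 0)).
Definition definable2 (P : V -> V -> Prop) := definable (fun e => P (e 0) (e 1)).
Definition definable3 (P : V -> V -> V -> Prop) :=
  definable (fun e => P (e 0) (e 1) (e 2)).

Lemma definable_app1 P t :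
  definable1 P -> dterm t -> definable (fun e => P (t e)).
Proof.
by move=> dP; apply: (@definable_subst (fun=> P)).
Qed.

Lemma definable_app2 P t u :
  definable2 P -> dterm t -> dterm u -> definable (fun e => P (t e) (u e)).
Proof.
move=> dP dt du.
apply: (@definable_subst (fun e y => P (t e) y)) => //.
apply: (@definable_subst (fun e x => P x (e 0))); last exact: (dterm_rename S).
exact: dP.
Qed.

Lemma definable_app3 P t u w : definable3 P -> dterm t -> dterm u -> dterm w ->
  definable (fun e => P (t e) (u e) (w e)).
Proof.
move=> dP dt du dw.
apply: (@definable_subst (fun e y => P (t e) (u e) y)) => //.
apply: (@definable_subst (fun e y => P (t (fun n => e n.+1)) y (e 0)));
  last exact: (dterm_rename S).
apply: (@definable_subst (fun e x => P x (e 0) (e 1)));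
  last exact: (dterm_rename (fun n => n.+2)).
exact: dP.
Qed.

Lemma definable_mem t u :
  dterm t -> dterm u -> definable (fun e => mem (t e) (u e)).
Proof. by apply: definable_app2; apply: definable_mem_var. Qed.

Lemma definable_eq t u :
  dterm t -> dterm u -> definable (fun e => t e = u e).
Proof. by apply: definable_app2; apply: definable_eq_var. Qed.

Lemma definable_true (b : Prop) : b -> definable (fun=> b).
Proof.
move=> hb; have [x _] := ZF_inhabited; exists (FImp FBot FBot), (fun=> x).
by move=> e /=; split.
Qed.

(** A proposition not depending on the environment is definable. *)
Lemma definable_closed (b : Prop) : definable (fun=> b).
Proof.
have [hb|hb] := pselect b; first exact: definable_true.
by apply: (definable_ext _ (definable_not (definable_true I))) => e; tauto.
Qed.

Lemma separation P a : definable1 P ->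
  exists b, forall x, mem x b <-> mem x a /\ P x.
Proof.
move=> [phi [c hP]]; have [x0 _] := ZF_inhabited.
pose e := mix (fun=> x0) c.
have [b hb] := zf_separation hV (rename bind phi) e a.
exists b => x; rewrite hb; have -> // : sat (scons x e) (rename bind phi) <-> P x.
by rewrite (sat_rename _ (mix_bind x _ c)) hP.
Qed.

End Definability.

(** * Elementary set theory *)

(** Additional rules for [defn], redefined as more notions become available. *)
Ltac defn_ext := fail.

Ltac defn_step :=
  cbv beta;
  first
  [ assumption
  | simple apply definable_closed
  | simple apply dterm_var
  | simple apply dterm_const
  | defn_ext
  | simple apply definable_iff
  | simple apply definable_and
  | simple apply definable_or
  | simple apply definable_not
  | simple apply definable_imp
  | simple apply definable_all
  | simple apply definable_ex
  | simple apply definable_mem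
  | simple apply definable_eq
  | match goal with
    | H : definable1 _ |- _ => refine (definable_app1 H _)
    | H : definable2 _ |- _ => refine (definable_app2 H _ _)
    | H : definable3 _ |- _ => refine (definable_app3 H _ _ _)
    end
  | progress unfold definable1, definable2, definable3
  | progress unfold unique, subset, nonempty, is_empty, is_upair, is_union,
      is_power, is_inter, is_diff, is_succ, rel, is_opair ].

(** [defn] proves that a concrete predicate is definable, by recursion on its shape. *)
Ltac defn := repeat defn_step.

Section SetTheory.
Variable V : set_structure.
Context {hV : ZF V}.
Implicit Types a b c f p s t u w x y z : V.

Lemma ext a b : (forall x, mem x a <-> mem x b) -> a = b.
Proof. exact: (zf_extensionality hV). Qed.

Lemma upair_inj p x y x' y' : is_upair p x y -> is_upair p x' y' ->
  (x = x' /\ y = y') \/ (x = y' /\ y = x').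
Proof.
move=> h h'.
have := proj1 (h' x) (proj2 (h x) (or_introl erefl)).
have := proj1 (h' y) (proj2 (h y) (or_intror erefl)).
have := proj1 (h x') (proj2 (h' x') (or_introl erefl)).
have := proj1 (h y') (proj2 (h' y') (or_intror erefl)).
by move=> [->|->] [->|->] [e|e] [e'|e']; subst; tauto.
Qed.

Lemma upair_uniq p q x y : is_upair p x y -> is_upair q x y -> p = q.
Proof. by move=> h h'; apply: ext => t; rewrite h h'. Qed.

Lemma opair_ex x y : exists p, is_opair p x y.
Proof.
have [s hs] := zf_pairing hV x x; have [t ht] := zf_pairing hV x y.
have [p hp] := zf_pairing hV s t; exists p => r; rewrite hp; split.
- by move=> [->|->]; [left|right].
- by move=> [h|h]; [left; apply: (upair_uniq h hs)|right; apply: (upair_uniq h ht)].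
Qed.

Lemma opair_uniq p q x y : is_opair p x y -> is_opair q x y -> p = q.
Proof. by move=> h h'; apply: ext => t; rewrite h h'. Qed.

Lemma opair_inj p x y x' y' :
  is_opair p x y -> is_opair p x' y' -> x = x' /\ y = y'.
Proof.
move=> h h'.
have [s hs] := zf_pairing hV x x; have [t ht] := zf_pairing hV x y.
have [s' hs'] := zf_pairing hV x' x'; have [t' ht'] := zf_pairing hV x' y'.
have E1 := proj1 (h' s) (proj2 (h s) (or_introl hs)).
have E2 := proj1 (h' t) (proj2 (h t) (or_intror ht)).
have E3 := proj1 (h s') (proj2 (h' s') (or_introl hs')).
have E4 := proj1 (h t') (proj2 (h' t') (or_intror ht')).
have F1 : x = x' by case: E1 => E1; have := upair_inj hs E1; intuition congruence.
subst x'; split=> //.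
by case: E2 => E2; have := upair_inj ht E2; case: E4 => E4;
  have := upair_inj ht' E4; intuition congruence.
Qed.

Lemma rel_opair f p x y : is_opair p x y -> rel f x y <-> mem p f.
Proof.
move=> hp; split=> [[q [hq h]]|h]; last by exists p.
by rewrite (opair_uniq hp hq).
Qed.

Lemma union2 a b : exists c, forall x, mem x c <-> mem x a \/ mem x b.
Proof.
have [p hp] := zf_pairing hV a b; have [u hu] := zf_union hV p.
exists u => x; rewrite hu; split.
- by move=> [y [/hp[->|->] h]]; tauto.
- by move=> [h|h]; [exists a|exists b]; split=> //; apply/hp; tauto.
Qed.

Lemma product_ex a b : exists c, is_product c a b.
Proof.
have [u hu] := union2 a b; have [P hP] := zf_power hV u.
have [Q hQ] := zf_power hV P.
have [c hc] := @separation _ _ (fun p => exists x y, mem x a /\ mem y b /\ is_opair p x y)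
  Q ltac:(defn).
exists c => p; rewrite hc; split=> [[] //|h]; split=> //.
case: h => x [y [ha [hb hp]]].
apply/hQ => t /hp ht; apply/hP => r hr; apply/hu.
by case: ht => ht; case/ht: hr => ->; tauto.
Qed.

(** The set of the pairs in [a * b] that satisfy a definable relation. *)
Lemma relation_ex a b P : definable2 P -> exists f,
  (forall p, mem p f -> exists x y, mem x a /\ mem y b /\ is_opair p x y) /\
  forall x y, rel f x y <-> mem x a /\ mem y b /\ P x y.
Proof.
move=> dP; have [c hc] := product_ex a b.
have [f hf] := @separation _ _ (fun p => exists x y, is_opair p x y /\ P x y) c
  ltac:(defn).
exists f; split=> [p /hf[/hc //]|x y].
have [p hp] := opair_ex x y; rewrite (rel_opair _ hp) hf hc; split.
- move=> [[x1 [y1 [h1 [h2 h3]]]] [x2 [y2 [h4 h5]]]].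
  have [? ?] := opair_inj hp h3; have [? ?] := opair_inj hp h4; subst.
  by split.
- by move=> [h1 [h2 h3]]; split; exists x, y.
Qed.

Lemma rel_dom_cod f a b x y : is_function f a b -> rel f x y -> mem x a /\ mem y b.
Proof.
move=> [hf _] [p [hp /hf [x' [y' [hx [hy hp']]]]]].
by have [-> ->] := opair_inj hp hp'.
Qed.

Lemma function_ex a b P : definable2 P ->
  (forall x, mem x a -> exists! y, mem y b /\ P x y) ->
  exists f, is_function f a b /\
    forall x y, rel f x y <-> mem x a /\ mem y b /\ P x y.
Proof.
move=> dP hP; have [f [h1 h2]] := relation_ex a b dP.
exists f; split=> //; split=> // x hx.
have [y [[hy hxy] hu]] := hP x hx; exists y; split; first by apply/h2.
by move=> z /h2 [_ hz]; apply: hu.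
Qed.

Lemma rel_uniq f a b x y y' :
  is_function f a b -> rel f x y -> rel f x y' -> y = y'.
Proof.
move=> hf h h'; have [hx _] := rel_dom_cod hf h.
have [z [_ hz]] := proj2 hf x hx.
by rewrite -(hz y) // (hz y').
Qed.

Lemma rel_ex f a b x : is_function f a b -> mem x a -> exists y, mem y b /\ rel f x y.
Proof.
move=> hf hx; have [y [hy _]] := proj2 hf x hx.
by exists y; split=> //; have [] := rel_dom_cod hf hy.
Qed.

Lemma omega_ex : exists w, is_omega w.
Proof.
have [w0 hw0] := zf_infinity hV.
have [w hw] := @separation _ _ (fun x => forall a, inductive a -> mem x a) w0
  ltac:(unfold inductive; defn).
exists w; split.
- split.
  + have [[e [he _]] _] := hw0; exists e; split=> //.
    have h a : inductive a -> mem e a.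
      move=> [[e' [he' h]] _].
      rewrite (_ : e = e') //; apply: ext => x.
      by split=> hx; [case: (he x)|case: (he' x)].
    by apply/hw; split; [apply: h|].
  + move=> x /hw [hx hx']; have [s [hs hs']] := proj2 hw0 x hx.
    exists s; split=> //; apply/hw; split=> // a ha.
    have [s' [h1 h2]] := proj2 ha x (hx' a ha).
    by rewrite (_ : s = s') //; apply: ext => t; rewrite hs h1.
- by move=> a ha x /hw [_]; apply.
Qed.

Lemma omega_uniq w w' : is_omega w -> is_omega w' -> w = w'.
Proof.
move=> [h1 h2] [h3 h4]; apply: ext => x.
by split; [apply: h2|apply: h4].
Qed.

Lemma omega_ind w P : is_omega w -> definable1 P ->
  (forall x, is_empty x -> P x) ->
  (forall x s, mem x w -> P x -> is_succ s x -> P s) ->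
  forall x, mem x w -> P x.
Proof.
move=> [[h0 hS] hw] dP P0 PS.
have [a ha] := separation w dP.
suff: inductive a by move=> /hw h x /h /ha [].
split.
- by have [e [he hew]] := h0; exists e; split=> //; apply/ha; split=> //; apply: P0.
- move=> x /ha [hx Px]; have [s [hs hsw]] := hS x hx.
  by exists s; split=> //; apply/ha; split=> //; apply: PS Px hs.
Qed.

Lemma no_mem_cycle2 x y : mem x y -> mem y x -> False.
Proof.
move=> h h'; have [p hp] := zf_pairing hV x y.
have [|z [/hp hz hz']] := zf_foundation hV (a := p).
  by exists x; apply/hp; left.
case: hz => ?; subst z.
- by apply: (hz' y) => //; apply/hp; right.
- by apply: (hz' x) => //; apply/hp; left.
Qed.

Lemma succ_inj s x y : is_succ s x -> is_succ s y -> x = y.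
Proof.
move=> h h'.
have [h1|//] := proj1 (h' x) (proj2 (h x) (or_intror erefl)).
have [h2|//] := proj1 (h y) (proj2 (h' y) (or_intror erefl)).
by case: (no_mem_cycle2 h1 h2).
Qed.

(** A finite non-empty set has a least element for each definable total
    preorder. *)
Lemma finite_least a (L : V -> V -> Prop) : definable2 L ->
  (forall x y, mem x a -> mem y a -> L x y \/ L y x) ->
  (forall x y z, L x y -> L y z -> L x z) ->
  finite a -> nonempty a ->
  exists x, mem x a /\ forall y, mem y a -> L x y.
Proof.
move=> dL tot tr [w [n [hw [hn [f [hf [finj fsurj]]]]]]] [x0 hx0].
pose P m := (exists x y, mem x a /\ mem y m /\ rel f x y) ->
  exists x, mem x a /\ (exists y, mem y m /\ rel f x y) /\
    forall x', mem x' a -> (exists y, mem y m /\ rel f x' y) -> L x x'.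
have dP : definable1 P by unfold P; defn.
have HP : forall m, mem m w -> P m.
  apply: omega_ind => // [x hx [x1 [y [_ [/hx //]]]]|m s hm Pm hs he].
  have refl x : mem x a -> L x x by move=> hx; case: (tot x x hx hx).
  have [[x1 [h1 h2]]|none] := pselect (exists x, mem x a /\ rel f x m).
  - have [/Pm [x2 [h3 [[y [h4 h5]] h6]]]|no] :=
      pselect (exists x y, mem x a /\ mem y m /\ rel f x y).
    + have last : forall x', rel f x' m -> x' = x1.
        by move=> x' hx'; apply: finj hx' h2.
      have [l|l] := tot x1 x2 h1 h3.
      * exists x1; split=> //; split.
          by exists m; split=> //; apply/hs; right.
        move=> x' hx' [z [/hs [hz|->] hx'z]].
          by apply: tr l _; apply: h6 => //; exists z.
        by rewrite (last _ hx'z); apply: refl.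
      * exists x2; split=> //; split.
          by exists y; split=> //; apply/hs; left.
        move=> x' hx' [z [/hs [hz|->] hx'z]]; first by apply: h6 => //; exists z.
        by rewrite (last _ hx'z).
    + exists x1; split=> //; split; first by exists m; split=> //; apply/hs; right.
      move=> x' hx' [z [/hs [hz|zm] hx'z]]; first by case: no; exists x', z.
      by rewrite zm in hx'z; rewrite (finj _ _ _ hx'z h2); apply: refl.
  - have old x y : mem y s -> rel f x y -> mem y m.
      move=> /hs [//|->] h; case: none; exists x; split=> //.
      by have [] := rel_dom_cod hf h.
    have [|x1 [h1 [[y [h2 h3]] h4]]] := Pm.
      by have [x [y [h1 [h2 h3]]]] := he; exists x, y; split=> //; split=> //; apply: old h3.
    exists x1; split=> //; split; first by exists y; split=> //; apply/hs; left.
    by move=> x' hx' [z [hz hx'z]]; apply: h4 => //; exists z; split=> //; apply: old hx'z.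
have [y0 [hy0 hr0]] := rel_ex hf hx0.
have [|x [hx [_ h]]] := HP n hn; first by exists x0, y0.
exists x; split=> // y hy; apply: h => //.
by have [z [hz hr]] := rel_ex hf hy; exists z.
Qed.

End SetTheory.

Import Order.TTheory GRing.Theory Num.Theory.
Local Open Scope ring_scope.

(** * The field of reals of a model *)

Section RealField.
Variable V : set_structure.
Context {hV : ZF V}.
Variables R zero one add mul lt : V.
Hypothesis hR : is_reals R zero one add mul lt.

Lemma op_ex o x y : is_binop o R -> mem x R -> mem y R ->
  exists z, mem z R /\ op o x y z.
Proof.
move=> [P [hP ho]] hx hy; have [p hp] := opair_ex x y.
have hpP : mem p P by apply/hP; exists x, y.
have [z [hz hr]] := rel_ex ho hpP.
by exists z; split=> //; exists p.
Qed.

Lemma op_uniq o x y z z' : is_binop o R -> op o x y z -> op o x y z' -> z = z'.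
Proof.
move=> [P [_ ho]] [p [hp h]] [q [hq h']].
by rewrite (opair_uniq hp hq) in h; apply: rel_uniq ho h h'.
Qed.

(** The reals of the model, as a type. The proof [hR] is an argument so that the
    instances below can be found from the type. *)
Definition real_type (_ : is_reals R zero one add mul lt) : Type :=
  {x : V | mem x R}.

Notation K := (real_type hR).

Definition real_val (x : K) : V := proj1_sig x.

Lemma real_val_inj : injective real_val.
Proof.
by case=> [x hx] [y hy]; rewrite /real_val /= => E; subst y; congr exist.
Qed.

Lemma real_val_mem x : mem (real_val x) R.
Proof. exact: (proj2_sig x). Qed.

Lemma real_val_surj x : mem x R -> exists y, x = real_val y.
Proof. by move=> hx; exists (exist _ x hx). Qed.

Lemma op_real_ex o (x y : K) : is_binop o R ->
  exists z : K, op o (real_val x) (real_val y) (real_val z).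
Proof.
move=> ho; have [z [hz h]] := op_ex ho (real_val_mem x) (real_val_mem y).
by exists (exist _ z hz).
Qed.

Definition radd (x y : K) : K :=
  projT1 (cid (op_real_ex x y (reals_add hR))).
Definition rmul (x y : K) : K :=
  projT1 (cid (op_real_ex x y (reals_mul hR))).
Definition rzero : K := exist _ zero (reals_zero hR).
Definition rone : K := exist _ one (reals_one hR).

Lemma raddP x y : op add (real_val x) (real_val y) (real_val (radd x y)).
Proof. exact: (projT2 (cid (op_real_ex x y (reals_add hR)))). Qed.

Lemma rmulP x y : op mul (real_val x) (real_val y) (real_val (rmul x y)).
Proof. exact: (projT2 (cid (op_real_ex x y (reals_mul hR)))). Qed.

Lemma raddE x y z : op add (real_val x) (real_val y) (real_val z) -> radd x y = z.
Proof. by move=> h; apply: real_val_inj; exact: (op_uniq (reals_add hR) (raddP x y) h). Qed.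

Lemma rmulE x y z : op mul (real_val x) (real_val y) (real_val z) -> rmul x y = z.
Proof. by move=> h; apply: real_val_inj; exact: (op_uniq (reals_mul hR) (rmulP x y) h). Qed.

Lemma radd_opp_ex (x : K) : exists y : K, radd x y = rzero.
Proof.
have [y hy] := reals_addN hR (real_val_mem x).
have [p [hp hr]] := hy; have [P [hP ho]] := reals_add hR.
have [/hP [x' [y' [hx' [hy' hp']]]] _] := rel_dom_cod ho hr.
have [_ Ey] := opair_inj hp hp'; subst y'.
by exists (exist _ y hy'); apply: raddE.
Qed.

Lemma rmul_inv_ex (x : K) : exists y : K,
  (x <> rzero -> rmul x y = rone) /\ (x = rzero -> y = rzero).
Proof.
have [->|nx] := pselect (x = rzero); first by exists rzero.
have nx' : real_val x <> zero by move=> h; apply: nx; apply: real_val_inj.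
have [y hy] := reals_mulV hR (real_val_mem x) nx'.
have [p [hp hr]] := hy; have [P [hP ho]] := reals_mul hR.
have [/hP [x' [y' [hx' [hy' hp']]]] _] := rel_dom_cod ho hr.
have [_ Ey] := opair_inj hp hp'; subst y'.
by exists (exist _ y hy'); split=> // _; apply: rmulE.
Qed.

Definition ropp (x : K) : K := projT1 (cid (radd_opp_ex x)).
Definition rinv (x : K) : K := projT1 (cid (rmul_inv_ex x)).

Lemma raddC : commutative radd.
Proof. by move=> x y; apply: raddE; apply: (reals_addC hR); apply: raddP. Qed.

Lemma raddA : associative radd.
Proof.
move=> x y z; apply: raddE.
exact: (reals_addA hR (raddP x y) (raddP y z) (raddP (radd x y) z)).
Qed.

Lemma radd0 : left_id rzero radd.
Proof.
move=> x; rewrite raddC; apply: raddE.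
exact: (reals_add0 hR (real_val_mem x)).
Qed.

Lemma raddN : left_inverse rzero ropp radd.
Proof. by move=> x; rewrite raddC; apply: (projT2 (cid (radd_opp_ex x))). Qed.

HB.instance Definition _ := gen_eqMixin K.
HB.instance Definition _ := gen_choiceMixin K.
HB.instance Definition _ := GRing.isZmodule.Build K raddA raddC radd0 raddN.

Lemma rmulC : commutative rmul.
Proof. by move=> x y; apply: rmulE; apply: (reals_mulC hR); apply: rmulP. Qed.

Lemma rmulA : associative rmul.
Proof.
move=> x y z; apply: rmulE.
exact: (reals_mulA hR (rmulP x y) (rmulP y z) (rmulP (rmul x y) z)).
Qed.

Lemma rmul1 : left_id rone rmul.
Proof.
move=> x; rewrite rmulC; apply: rmulE.
exact: (reals_mul1 hR (real_val_mem x)).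
Qed.

Lemma rmulD : left_distributive rmul radd.
Proof.
move=> x y z; rewrite rmulC; symmetry; apply: raddE; rewrite !(rmulC _ z).
exact: (reals_mulD hR (raddP x y) (rmulP z x) (rmulP z y) (rmulP z (radd x y))).
Qed.

Lemma rone_neq0 : rone != 0.
Proof. by apply/eqP => h; apply: (reals_01 hR); rewrite -[zero]/(real_val 0) -h. Qed.

HB.instance Definition _ :=
  GRing.Zmodule_isComNzRing.Build K rmulA rmulC rmul1 rmulD rone_neq0.

Lemma rmulV (x : K) : x != 0 -> rinv x * x = 1.
Proof.
move=> /eqP nx; rewrite mulrC.
exact: (proj1 (projT2 (cid (rmul_inv_ex x)))).
Qed.

Lemma rinv0 : rinv 0 = 0.
Proof. exact: (proj2 (projT2 (cid (rmul_inv_ex 0)))). Qed.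

HB.instance Definition _ := GRing.ComNzRing_isField.Build K rmulV rinv0.

Definition rlt (x y : K) : bool := `[< Defs.rel lt (real_val x) (real_val y) >].
Definition rle (x y : K) : bool := (x == y) || rlt x y.
Definition rnorm (x : K) : K := if rle 0 x then x else - x.

Lemma rlt_irr x : rlt x x = false.
Proof. by apply/asboolP; apply: reals_lt_irrefl hR _. Qed.

Lemma rlt_trans x y z : rlt x y -> rlt y z -> rlt x z.
Proof. by move=> /asboolP h /asboolP h'; apply/asboolP; apply: (reals_lt_trans hR h h'). Qed.

Lemma rlt_addr z x y : rlt x y -> rlt (x + z) (y + z).
Proof.
move=> /asboolP h; apply/asboolP.
exact: (reals_lt_add hR h (raddP x z) (raddP y z)).
Qed.

Lemma rsub_gt0 x y : rlt 0 (y - x) = rlt x y.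
Proof.
apply/idP/idP => h.
- by have := rlt_addr x h; rewrite add0r subrK.
- by have := rlt_addr (- x) h; rewrite subrr.
Qed.

Lemma rlt0_add x y : rlt 0 x -> rlt 0 y -> rlt 0 (x + y).
Proof.
by move=> hx hy; apply: rlt_trans hy _; have := rlt_addr y hx; rewrite add0r.
Qed.

Lemma rlt0_mul x y : rlt 0 x -> rlt 0 y -> rlt 0 (x * y).
Proof.
move=> /asboolP hx /asboolP hy; apply/asboolP.
exact: (reals_lt_mul hR hx hy (rmulP x y)).
Qed.

Lemma rlt0_ngt0 x : rlt 0 x -> ~~ rlt x 0.
Proof. by move=> h; apply/negP => h'; have := rlt_trans h h'; rewrite rlt_irr. Qed.

Lemma rlt0_total x : x != 0 -> rlt 0 x || rlt x 0.
Proof.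
move=> /eqP nx.
have [h|[h|h]] := reals_lt_total hR (real_val_mem 0) (real_val_mem x).
- by apply/orP; left; apply/asboolP.
- by case: nx; apply: real_val_inj.
- by apply/orP; right; apply/asboolP.
Qed.

Lemma rltN x : rlt 0 (- x) = rlt x 0.
Proof. by rewrite -[- x]add0r rsub_gt0. Qed.

Lemma rnormN x : rnorm (- x) = rnorm x.
Proof.
rewrite /rnorm /rle rltN !(eq_sym 0) oppr_eq0 opprK.
have [->|nx] := eqVneq x 0; first by rewrite oppr0.
have := rlt0_total nx; have [h _|_ /= ->] := boolP (rlt 0 x) => //=.
by rewrite (negbTE (rlt0_ngt0 h)).
Qed.

Lemma rge0_norm x : rle 0 x -> rnorm x = x.
Proof. by rewrite /rnorm => ->. Qed.

HB.instance Definition _ := Num.IntegralDomain_isLtReal.Build K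
  rlt0_add rlt0_mul rlt0_ngt0 rsub_gt0 rlt0_total rnormN rge0_norm
  (fun _ _ => erefl).

Definition real_field : realFieldType := K.

End RealField.

(** A realFieldType [K] that is isomorphic to the reals of the model through
    [v]. *)
Record reals_model (V : set_structure) (R lt add mul : V)
    (K : realFieldType) (v : K -> V) : Prop := {
  val_inj : injective v;
  val_mem : forall x, mem (v x) R;
  val_surj : forall x, mem x R -> exists y, x = v y;
  val_add : forall x y z, op add (v x) (v y) z <-> z = v (x + y);
  val_mul : forall x y z, op mul (v x) (v y) z <-> z = v (x * y);
  val_lt : forall x y, Defs.rel lt (v x) (v y) <-> x < y
}.

Lemma reals_model_ex (V : set_structure) (hV : ZF V)
  (R zero one add mul lt : V) (hR : is_reals R zero one add mul lt) :
  exists (K : realFieldType) (v : K -> V), reals_model R lt add mul v.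
Proof.
exists (real_field hR), (@real_val _ _ _ _ _ _ _ hR); split.
- exact: real_val_inj.
- exact: real_val_mem.
- exact: real_val_surj.
- move=> x y z; split=> [h|->]; last exact: raddP.
  exact: (op_uniq (reals_add hR) h (raddP x y)).
- move=> x y z; split=> [h|->]; last exact: rmulP.
  exact: (op_uniq (reals_mul hR) h (rmulP x y)).
- by move=> x y; split=> /asboolP.
Qed.

(** * Definability over the reals *)

Section Analysis.
Variable V : set_structure.
Context {hV : ZF V}.
Variables R zero one add mul lt : V.
Hypothesis hR : is_reals R zero one add mul lt.
Variables (K : realFieldType) (v : K -> V).
Hypothesis hK : reals_model R lt add mul v.

(** The inverse of [v], with value 0 outside of the set of reals. *)
Definition real_of (x : V) : K :=
  if pselect (exists y, x = v y) is left h then projT1 (cid h) else 0.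

Lemma real_ofK : cancel v real_of.
Proof.
move=> x; rewrite /real_of; case: pselect => [h|[]]; last by exists x.
by apply: (val_inj hK); case: (cid h).
Qed.

Lemma val_real_of x : mem x R -> v (real_of x) = x.
Proof. by move=> /(val_surj hK)[y ->]; rewrite real_ofK. Qed.

(** Definable terms with values in [K]. *)
Definition rterm (t : (nat -> V) -> K) : Prop := dterm (fun e => v (t e)).

Lemma dterm_val t : rterm t -> dterm (fun e => v (t e)).
Proof. by []. Qed.

Lemma rterm_const x : rterm (fun=> x).
Proof. exact: dterm_const. Qed.

Lemma rterm_rename r t : rterm t -> rterm (fun e => t (fun n => e (r n))).
Proof. exact: dterm_rename. Qed.

Lemma rterm_real_of t : dterm t -> rterm (fun e => real_of (t e)).
Proof.
move=> /(dterm_rename S) dt.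
apply: (@definable_ext _ (fun e =>
  (mem (t (fun n => e n.+1)) R /\ e 0 = t (fun n => e n.+1)) \/
  (~ mem (t (fun n => e n.+1)) R /\ e 0 = v 0))); last by defn.
move=> e; set x := t _.
have [hx|hx] := pselect (mem x R); first by rewrite val_real_of //; tauto.
rewrite /real_of; case: pselect => [[y hy]|_]; last by tauto.
by case: hx; rewrite hy; apply: (val_mem hK).
Qed.

Lemma rterm_add t u : rterm t -> rterm u -> rterm (fun e => t e + u e).
Proof.
move=> /(rterm_rename S) dt /(rterm_rename S) du.
apply: (@definable_ext _ (fun e =>
  op add (v (t (fun n => e n.+1))) (v (u (fun n => e n.+1))) (e 0))).
  by move=> e; apply: (val_add hK).
by apply: (@definable_app3 _ (op add)); unfold op; defn.
Qed.

Lemma rterm_mul t u : rterm t -> rterm u -> rterm (fun e => t e * u e).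
Proof.
move=> /(rterm_rename S) dt /(rterm_rename S) du.
apply: (@definable_ext _ (fun e =>
  op mul (v (t (fun n => e n.+1))) (v (u (fun n => e n.+1))) (e 0))).
  by move=> e; apply: (val_mul hK).
by apply: (@definable_app3 _ (op mul)); unfold op; defn.
Qed.

Lemma rterm_opp t : rterm t -> rterm (fun e => - t e).
Proof.
move=> /(rterm_rename S) dt.
apply: (@definable_ext _ (fun e => mem (e 0) R /\
  op add (v (t (fun n => e n.+1))) (e 0) (v 0))).
  move=> e; split=> [[/(val_surj hK)[y ->]]|->].
    rewrite (val_add hK) => /(val_inj hK) h; congr v.
    by apply/eqP; rewrite -addr_eq0 addrC -h.
  by split; [apply: (val_mem hK)|apply/(val_add hK); rewrite subrr].
apply: definable_and; first by defn.
by apply: (@definable_app3 _ (op add)); unfold op; defn.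
Qed.

Lemma definable_req t u : rterm t -> rterm u -> definable (fun e => t e = u e).
Proof.
move=> dt du; apply: (@definable_ext _ (fun e => v (t e) = v (u e))); last by defn.
by move=> e; split=> [/(val_inj hK)|->].
Qed.

Lemma definable_rlt t u : rterm t -> rterm u -> definable (fun e => t e < u e).
Proof.
move=> dt du; apply: (@definable_ext _ (fun e => Defs.rel lt (v (t e)) (v (u e)))).
  by move=> e; apply: (val_lt hK).
by apply: (@definable_app2 _ (Defs.rel lt)); defn.
Qed.

Lemma definable_rle t u : rterm t -> rterm u -> definable (fun e => t e <= u e).
Proof.
move=> dt du; apply: (@definable_ext _ (fun e => ~ (u e < t e))).
  by move=> e; rewrite leNgt; split=> /negP.
by apply: definable_not; apply: definable_rlt.
Qed.

Lemma definable_rall (P : (nat -> V) -> K -> Prop) :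
  definable (fun e => P (fun n => e n.+1) (real_of (e 0))) ->
  definable (fun e => forall x, P e x).
Proof.
move=> dP; apply: (@definable_ext _ (fun e => forall x, P e (real_of x))).
  by move=> e; split=> h x //; rewrite -(real_ofK x).
exact: (@definable_all _ (fun e x => P e (real_of x))).
Qed.

Lemma definable_rex (P : (nat -> V) -> K -> Prop) :
  definable (fun e => P (fun n => e n.+1) (real_of (e 0))) ->
  definable (fun e => exists x, P e x).
Proof.
move=> dP; apply: (@definable_ext _ (fun e => exists x, P e (real_of x))).
  move=> e; split=> [[x h]|[x h]]; first by exists (real_of x).
  by exists (v x); rewrite real_ofK.
exact: (@definable_ex _ (fun e x => P e (real_of x))).
Qed.

Lemma definable_rsubst (P : (nat -> V) -> K -> Prop) t :
  definable (fun e => P (fun n => e n.+1) (real_of (e 0))) -> rterm t ->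
  definable (fun e => P e (t e)).
Proof.
move=> dP dt.
apply: (@definable_ext _ (fun e => P e (real_of (v (t e))))).
  by move=> e; rewrite real_ofK.
exact: (@definable_subst _ (fun e x => P e (real_of x))).
Qed.

(** Definable predicates with real arguments. *)
Definition definableR (P : K -> Prop) := definable (fun e => P (real_of (e 0))).
Definition definableRR (P : K -> K -> Prop) :=
  definable (fun e => P (real_of (e 0)) (real_of (e 1))).
Definition definableVR (P : V -> K -> Prop) :=
  definable (fun e => P (e 0) (real_of (e 1))).
Definition definableRV (P : K -> V -> Prop) :=
  definable (fun e => P (real_of (e 0)) (e 1)).

Lemma definable_appR P t :
  definableR P -> rterm t -> definable (fun e => P (t e)).
Proof. by move=> dP; apply: (@definable_rsubst (fun=> P)). Qed.

Lemma definable_appRR P t u :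
  definableRR P -> rterm t -> rterm u -> definable (fun e => P (t e) (u e)).
Proof.
move=> dP dt du.
apply: (@definable_ext _ (fun e => P (real_of (v (t e))) (real_of (v (u e))))).
  by move=> e; rewrite !real_ofK.
exact: (@definable_app2 _ (fun x y => P (real_of x) (real_of y))).
Qed.

Lemma definable_appVR P t u :
  definableVR P -> dterm t -> rterm u -> definable (fun e => P (t e) (u e)).
Proof.
move=> dP dt du.
apply: (@definable_ext _ (fun e => P (t e) (real_of (v (u e))))).
  by move=> e; rewrite !real_ofK.
exact: (@definable_app2 _ (fun x y => P x (real_of y))).
Qed.

Lemma definable_appRV P t u :
  definableRV P -> rterm t -> dterm u -> definable (fun e => P (t e) (u e)).
Proof.
move=> dP dt du.
apply: (@definable_ext _ (fun e => P (real_of (v (t e))) (u e))).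
  by move=> e; rewrite !real_ofK.
exact: (@definable_app2 _ (fun x y => P (real_of x) y)).
Qed.

Ltac defn_real := first
  [ simple apply rterm_const
  | simple apply rterm_add
  | simple apply rterm_mul
  | simple apply rterm_opp
  | simple apply rterm_real_of
  | simple apply dterm_val
  | simple apply definable_req
  | simple apply definable_rlt
  | simple apply definable_rle
  | simple apply definable_rall
  | simple apply definable_rex
  | match goal with
    | H : definableR _ |- _ => refine (definable_appR H _)
    | H : definableRR _ |- _ => refine (definable_appRR H _ _)
    | H : definableVR _ |- _ => refine (definable_appVR H _ _)
    | H : definableRV _ |- _ => refine (definable_appRV H _ _)
    end
  | progress unfold definableR, definableRR, definableVR, definableRV ].
Ltac defn_ext ::= defn_real.

(** The set of the reals that satisfy a definable predicate. *)
Lemma real_set_ex (P : K -> Prop) : definableR P ->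
  exists a, subset a R /\ forall x, mem (v x) a <-> P x.
Proof.
move=> dP; have [a ha] := @separation _ _ (fun x => P (real_of x)) R dP.
exists a; split=> [x /ha[] //|x].
by rewrite ha real_ofK; split=> [[]|] // h; split=> //; apply: (val_mem hK).
Qed.

Lemma real_sup (P : K -> Prop) : definableR P -> (exists x, P x) ->
  (exists b, forall x, P x -> x <= b) ->
  exists b, (forall x, P x -> x <= b) /\ forall c, (forall x, P x -> x <= c) -> b <= c.
Proof.
move=> dP [x0 hx0] [b0 hb0]; have [a [haR ha]] := real_set_ex dP.
have ub c : (forall x, mem x a -> ~ Defs.rel lt (v c) x) <-> forall x, P x -> x <= c.
  split=> h x hx; first by rewrite leNgt; apply/negP => /(val_lt hK); apply: h; apply/ha.
  have [y hy] := val_surj hK (haR x hx); subst x => /(val_lt hK).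
  by rewrite ltNge => /negP; apply; apply: h; apply/ha.
have [||b [hbR [hb1 hb2]]] := reals_sup hR haR.
- by exists (v x0); apply/ha.
- by exists (v b0); split; [apply: (val_mem hK)|apply/ub].
have [b' hb'] := val_surj hK hbR; subst b; exists b'; split; first exact/ub.
move=> c hc; rewrite leNgt; apply/negP => /(val_lt hK).
by apply: hb2; [apply: (val_mem hK)|apply/ub].
Qed.

Lemma real_inf (P : K -> Prop) : definableR P -> (exists x, P x) ->
  (exists b, forall x, P x -> b <= x) ->
  exists b, (forall x, P x -> b <= x) /\ forall c, (forall x, P x -> c <= x) -> c <= b.
Proof.
move=> dP [x0 hx0] [b0 hb0].
have [|||b [hb1 hb2]] := @real_sup (fun x => P (- x)); first by defn.
- by exists (- x0); rewrite opprK.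
- by exists (- b0) => x /hb0; rewrite lerNr.
exists (- b); split=> [x hx|c hc]; first by rewrite lerNl; apply: hb1; rewrite opprK.
by rewrite lerNr; apply: hb2 => x /hc; rewrite lerNr.
Qed.

(** * Natural numbers among the reals *)

(** [h] contains 0 and is closed under adding 1. *)
Definition peano_closed (h : V) : Prop :=
  mem (v 0) h /\ forall x, mem (v x) h -> mem (v (x + 1)) h.

Lemma naturals_ex : exists a, subset a R /\
  forall x, mem (v x) a <-> forall h, peano_closed h -> mem (v x) h.
Proof. by apply: real_set_ex; unfold peano_closed; defn. Qed.

Definition naturals : V := projT1 (cid naturals_ex).

(** [x] is a natural number in the sense of the model. *)
Definition nat_real (x : K) : Prop := mem (v x) naturals.
Notation N := nat_real.

Lemma naturals_sub : subset naturals R.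
Proof. exact: (proj1 (projT2 (cid naturals_ex))). Qed.

Lemma nat_realP x : N x <-> forall h, peano_closed h -> mem (v x) h.
Proof. exact: (proj2 (projT2 (cid naturals_ex))). Qed.

Lemma naturals_val x : mem x naturals -> exists y, N y /\ x = v y.
Proof.
by move=> hx; have [y hy] := val_surj hK (naturals_sub hx); exists y; split=> //; subst x.
Qed.

Lemma definable_nat t : rterm t -> definable (fun e => N (t e)).
Proof. by move=> dt; unfold nat_real; defn. Qed.

Ltac defn_nat := first [ simple apply definable_nat | defn_real ].
Ltac defn_ext ::= defn_nat.

Lemma nat0 : N 0.
Proof. by apply/nat_realP => h []. Qed.

Lemma natS x : N x -> N (x + 1).
Proof. by move=> /nat_realP hx; apply/nat_realP => h hh; apply: (proj2 hh); apply: hx. Qed.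

Lemma nat_ind (P : K -> Prop) : definableR P -> P 0 ->
  (forall x, N x -> P x -> P (x + 1)) -> forall x, N x -> P x.
Proof.
move=> dP P0 PS.
have [|a [_ ha]] := @real_set_ex (fun x => N x /\ P x); first by defn.
move=> x /nat_realP hx; suff /hx /ha [] : peano_closed a by [].
split; first by apply/ha; split=> //; apply: nat0.
by move=> y /ha [Ny Py]; apply/ha; split; [apply: natS|apply: PS].
Qed.

Lemma nat_ge0 x : N x -> 0 <= x.
Proof. by move: x; apply: nat_ind => [||x _ h]; [defn| |lra]. Qed.

Lemma natS_neq0 x : N x -> x + 1 <> 0.
Proof. by move=> /nat_ge0 h e; lra. Qed.

Lemma nat_case x : N x -> x = 0 \/ exists y, N y /\ x = y + 1.
Proof.
move: x; apply: nat_ind => [||x Nx _]; [by defn|by left|by right; exists x].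
Qed.

Lemma natD x y : N x -> N y -> N (x + y).
Proof.
move=> Nx; move: y; apply: nat_ind => [||y Ny h]; first by defn.
- by rewrite addr0.
- by rewrite addrA; apply: natS.
Qed.

Lemma natM x y : N x -> N y -> N (x * y).
Proof.
move=> Nx; move: y; apply: nat_ind => [||y Ny h]; first by defn.
- by rewrite mulr0; apply: nat0.
- by rewrite mulrDr mulr1; apply: natD.
Qed.

Lemma nat_lt_succ x y : N x -> N y -> x < y -> x + 1 <= y.
Proof.
move=> Nx; move: x Nx y; apply: nat_ind => [||x Nx IH y Ny]; first by defn.
- move=> y /nat_case [->|[z [/nat_ge0 h ->]]] h'; lra.
- have [->|[z [Nz ->]]] := nat_case Ny; first by have := nat_ge0 Nx; lra.
  by move=> h; have := IH z Nz; lra.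
Qed.

Lemma nat_ltS x y : N x -> N y -> x < y + 1 -> x <= y.
Proof. by move=> Nx Ny h; rewrite leNgt; apply/negP => /(nat_lt_succ Ny Nx); lra. Qed.

Lemma nat_least (P : K -> Prop) : definableR P -> (exists x, N x /\ P x) ->
  exists x, N x /\ P x /\ forall y, N y -> P y -> x <= y.
Proof.
move=> dP [x0 [Nx0 Px0]]; apply: contrapT => no.
have : forall x, N x -> forall y, N y -> y <= x -> ~ P y.
  apply: nat_ind => [||x Nx IH y Ny yx Py]; first by defn.
  - move=> y Ny y0 Py; apply: no; exists y; split=> //; split=> // z Nz _.
    by have := nat_ge0 Nz; lra.
  - apply: no; exists y; split=> //; split=> // z Nz Pz.
    rewrite leNgt; apply/negP => zy; apply: (IH z) => //.
    by apply: nat_ltS => //; lra.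
by move=> /(_ x0 Nx0 x0 Nx0); apply.
Qed.

Lemma nat_greatest (P : K -> Prop) b : definableR P -> (exists x, N x /\ P x) ->
  N b -> (forall x, N x -> P x -> x <= b) ->
  exists x, N x /\ P x /\ forall y, N y -> P y -> y <= x.
Proof.
move=> dP [x0 [Nx0 Px0]] Nb hb.
have [||m [Nm [hm least]]] :=
  @nat_least (fun m => forall x, N x -> P x -> x <= m); first by defn.
  by exists b.
have [Pm|nPm] := pselect (P m); first by exists m.
have [m0|[k [Nk mk]]] := nat_case Nm.
  case: nPm; rewrite (_ : m = x0) //.
  by have := hm _ Nx0 Px0; have := nat_ge0 Nx0; lra.
have : m <= k; last by lra.
apply: least => // x Nx Px; apply: nat_ltS => //.
rewrite -mk lt_neqAle hm // andbT; apply/eqP => E; apply: nPm.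
by rewrite -E.
Qed.

(** * Recursion *)

(** The function is the least relation between [naturals] and [B] that contains
    [(0, b0)] and is closed under the recursion step. *)

Lemma recursion_ex (B b0 : V) (G : K -> V -> V -> Prop) :
  definable (fun e => G (real_of (e 0)) (e 1) (e 2)) ->
  mem b0 B ->
  (forall x y, N x -> mem y B -> exists z, mem z B /\ G x y z) ->
  (forall x y z z', N x -> mem y B -> G x y z -> G x y z' -> z = z') ->
  exists f, is_function f naturals B /\ Defs.rel f (v 0) b0 /\
    forall x y z, N x -> Defs.rel f (v x) y -> G x y z -> Defs.rel f (v (x + 1)) z.
Proof.
move=> dG hb0 Gex Guniq.
have dG' : definable3 (fun x => G (real_of x)) by [].
pose closed h := Defs.rel h (v 0) b0 /\ forall x y z, N x -> mem y B ->
  Defs.rel h (v x) y -> G x y z -> Defs.rel h (v (x + 1)) z.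
have dGt t u w : rterm t -> dterm u -> dterm w -> definable (fun e => G (t e) (u e) (w e)).
  move=> dt du dw.
  apply: (@definable_ext _ (fun e => G (real_of (v (t e))) (u e) (w e))).
    by move=> e; rewrite real_ofK.
  exact: (@definable_app3 _ (fun x => G (real_of x))).
have [|f [hf hfr]] := @relation_ex _ _ naturals B
  (fun x y => forall h, closed h -> Defs.rel h x y).
  by unfold closed; defn; apply: dGt; defn.
have GB x y z : N x -> mem y B -> G x y z -> mem z B.
  move=> Nx hy Gz; have [z' [hz' Gz']] := Gex x y Nx hy.
  by rewrite (Guniq _ _ _ _ Nx hy Gz Gz').
have fclosed : closed f.
  split; first by apply/hfr; split; [apply: nat0|split=> // h []].
  move=> x y z Nx hy /hfr [_ [_ hxy]] Gz; apply/hfr; split; first exact: natS.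
  split; first exact: GB Gz.
  by move=> h hh; apply: (proj2 hh) Gz => //; apply: hxy.
have fmin h : closed h -> forall x y, Defs.rel f x y -> Defs.rel h x y.
  by move=> hh x y /hfr [_ [_]]; apply.
have remove x1 z1 : exists h, forall x y, Defs.rel h x y <->
    mem x naturals /\ mem y B /\ Defs.rel f x y /\ ~ (x = x1 /\ y = z1).
  have [|h [_ hh]] := @relation_ex _ _ naturals B
    (fun x y => Defs.rel f x y /\ ~ (x = x1 /\ y = z1)); first by defn.
  by exists h.
have uniq : forall x, N x -> exists! y, Defs.rel f (v x) y.
  apply: nat_ind => [||x Nx [y [hy uy]]]; first by defn.
  - exists b0; split; first exact: (proj1 fclosed).
    move=> y hy; apply: contrapT => ne; have [h hh] := remove (v 0) y.
    suff /fmin /(_ _ _ hy) /hh [_ [_ [_]]] : closed h by apply.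
    split.
      apply/hh; split; first exact: nat0.
      by do 2!split=> //; [apply: (proj1 fclosed)|move=> [_ /ne]].
    move=> x y' z Nx hy' /hh [_ [_ [hr _]]] Gz; apply/hh; split; first exact: natS.
    split; first exact: GB Gz.
    split; first exact: (proj2 fclosed) hr Gz.
    by move=> [/(val_inj hK) E _]; apply: natS_neq0 E.
  - have hyB : mem y B by have /hfr [_ []] := hy.
    have [z [hz Gz]] := Gex x y Nx hyB.
    have fz : Defs.rel f (v (x + 1)) z by apply: (proj2 fclosed) hy Gz.
    exists z; split=> // z' hz'; apply: contrapT => ne.
    have [h hh] := remove (v (x + 1)) z'.
    suff /fmin /(_ _ _ hz') /hh [_ [_ [_]]] : closed h by apply.
    split.
      apply/hh; split; first exact: nat0.
      split=> //; split; first exact: (proj1 fclosed).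
      by move=> [/(val_inj hK) /esym E _]; apply: natS_neq0 E.
    move=> x' y' z2 Nx' hy' /hh [_ [_ [hr _]]] Gz2; apply/hh; split; first exact: natS.
    split; first exact: GB Gz2.
    split; first exact: (proj2 fclosed) hr Gz2.
    move=> [/(val_inj hK) /addIr E Ez]; apply: ne; subst x' z2.
    by rewrite (uy _ hr) in Gz; apply: Guniq Gz Gz2.
exists f; split; [split|split] => //.
- by move=> x /naturals_val [y [Ny ->]]; apply: uniq.
- exact: (proj1 fclosed).
- move=> x y z Nx hxy; apply: (proj2 fclosed) => //.
  by have /hfr [_ []] := hxy.
Qed.

(** * Sequences of reals *)

(** The value at [x] of the function [f], from the natural numbers to the
    reals of the model; 0 where it is undefined. *)
Definition value (f : V) (x : K) : K :=
  if pselect (exists! y, Defs.rel f (v x) (v y)) is left h then projT1 (cid h) else 0.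

Notation real_sequence f := (is_function f naturals R).

Lemma value_rel f x : real_sequence f -> N x -> Defs.rel f (v x) (v (value f x)).
Proof.
move=> hf Nx; rewrite /value; case: pselect => [h|]; first by case: (cid h) => y [].
have [y [/(val_surj hK)[z ->] hz]] := rel_ex hf Nx; case; exists z; split=> // z' hz'.
by apply: (val_inj hK); apply: rel_uniq hf hz hz'.
Qed.

Lemma value_eq f x y : real_sequence f -> Defs.rel f (v x) (v y) -> value f x = y.
Proof.
move=> hf h; have [Nx _] := rel_dom_cod hf h.
by apply: (val_inj hK); apply: rel_uniq hf (value_rel hf Nx) h.
Qed.

Lemma rterm_value t u : dterm t -> rterm u -> rterm (fun e => value (t e) (u e)).
Proof.
move=> dt du; pose U f x := exists! y, Defs.rel f (v x) (v y).
apply: (@definable_ext _ (fun e => (fun f x z => (U f (real_of x) /\ mem z R /\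
   Defs.rel f (v (real_of x)) z) \/
  (~ U f (real_of x) /\ z = v 0)) (t (fun n => e n.+1)) (v (u (fun n => e n.+1))) (e 0))).
  move=> e; rewrite real_ofK /value; set f := t _; set x := u _.
  case: pselect => [h|no].
    case: (cid h) => y [hy uy] /=; split=> [[[_ [/(val_surj hK)[z ->] hz]]|[]] //|->].
      by rewrite (uy z hz).
    by left; split=> //; split=> //; apply: (val_mem hK).
  by split=> [[[/no]|[]]|] //; right.
apply: (@definable_app3 _ (fun f x z => (U f (real_of x) /\ mem z R /\
   Defs.rel f (v (real_of x)) z) \/ (~ U f (real_of x) /\ z = v 0))).
- by unfold U; defn.
- exact: (dterm_rename S).
- exact: (rterm_rename S).
- by defn.
Qed.

Ltac defn_value := first [ simple apply rterm_value | defn_nat ].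
Ltac defn_ext ::= defn_value.

Lemma function_ext f f' : real_sequence f -> real_sequence f' ->
  (forall x, N x -> value f x = value f' x) -> f = f'.
Proof.
have sub g g' : real_sequence g -> real_sequence g' ->
    (forall x, N x -> value g x = value g' x) -> forall p, mem p g -> mem p g'.
  move=> hg hg' E p hp.
  have [x [y [Nx [hy hxy]]]] := proj1 hg p hp.
  have [z [Nz ?]] := naturals_val Nx; subst x.
  have [y' ?] := val_surj hK hy; subst y.
  have h : Defs.rel g (v z) (v y') by exists p.
  apply/(rel_opair g' hxy); rewrite -(value_eq hg h) E //.
  exact: value_rel.
move=> hf hf' E; apply: ext => p; split; apply: sub => // x Nx.
by rewrite E.
Qed.

Lemma sequence_ex (G : K -> K -> Prop) : definableRR G ->
  (forall x, N x -> exists! y, G x y) ->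
  exists f, real_sequence f /\ forall x, N x -> G x (value f x).
Proof.
move=> dG hG.
have [||f [hf hfr]] := @function_ex _ _ naturals R (fun x y => G (real_of x) (real_of y)).
- by defn.
- move=> x /naturals_val [y [Ny ->]]; rewrite real_ofK.
  have [z [hz uz]] := hG y Ny; exists (v z); split.
    by rewrite real_ofK; split=> //; apply: (val_mem hK).
  by move=> z' [/val_real_of {2}<-] /uz ->.
exists f; split=> // x Nx; have /hfr [_ [_]] := value_rel hf Nx.
by rewrite !real_ofK.
Qed.

Lemma recursive_sequence_ex (c0 : K) (G : K -> K -> K -> Prop) :
  definable (fun e => G (real_of (e 0)) (real_of (e 1)) (real_of (e 2))) ->
  (forall x y, N x -> exists! z, G x y z) ->
  exists f, real_sequence f /\ value f 0 = c0 /\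
    forall x, N x -> G x (value f x) (value f (x + 1)).
Proof.
move=> dG hG.
have [||||f [hf [f0 fS]]] := @recursion_ex R (v c0)
  (fun x y z => mem z R /\ G x (real_of y) (real_of z)).
- by apply: definable_and; first by defn.
- exact: (val_mem hK).
- move=> x y Nx _; have [z [hz _]] := hG x (real_of y) Nx; exists (v z).
  by rewrite real_ofK; split; [apply: (val_mem hK)|split=> //; apply: (val_mem hK)].
- move=> x y z z' Nx _ [hz h] [hz' h'].
  have [z1 [_ u]] := hG x (real_of y) Nx.
  by rewrite -(val_real_of hz) -(val_real_of hz') -(u _ h) -(u _ h').
exists f; split=> //; split; first exact: value_eq.
move=> x Nx; have [z [hz uz]] := hG x (value f x) Nx.
have -> : value f (x + 1) = z; last by [].
apply: value_eq => //; apply: fS Nx (value_rel hf Nx) _.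
by rewrite !real_ofK; split=> //; apply: (val_mem hK).
Qed.

(** * Weights *)

Lemma archimedean (x : K) : exists n, N n /\ x < n.
Proof.
apply: contrapT => no.
have [|||b [hb least]] := @real_sup N; first by defn.
- by exists 0; apply: nat0.
- by exists x => n Nn; rewrite leNgt; apply/negP => h; apply: no; exists n.
have : b <= b - 1; last by lra.
by apply: least => n /natS /hb; lra.
Qed.

Lemma weights_ex : exists f, real_sequence f /\ value f 0 = 1 /\
  forall x, N x -> value f (x + 1) = value f x * 3^-1.
Proof.
apply: (@recursive_sequence_ex 1 (fun _ y z => z = y * 3^-1)); first by defn.
by move=> x y _; exists (y * 3^-1); split.
Qed.

Definition weights : V := projT1 (cid weights_ex).

(** [weight n] is 3 to the power -n. *)
Definition weight (x : K) : K := value weights x.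

Lemma rterm_weight t : rterm t -> rterm (fun e => weight (t e)).
Proof. by move=> dt; unfold weight; defn. Qed.

Ltac defn_weight := first [ simple apply rterm_weight | defn_value ].
Ltac defn_ext ::= defn_weight.

Lemma weight0 : weight 0 = 1.
Proof. exact: (proj1 (proj2 (projT2 (cid weights_ex)))). Qed.

Lemma weightS x : N x -> weight (x + 1) = weight x * 3^-1.
Proof. exact: (proj2 (proj2 (projT2 (cid weights_ex)))). Qed.

Lemma weight_gt0 x : N x -> 0 < weight x.
Proof.
move: x; apply: nat_ind => [||x Nx h]; first by defn.
- by rewrite weight0; lra.
- by rewrite weightS //; lra.
Qed.

Lemma weight_lt x y : N x -> N y -> x < y -> weight y <= weight x * 3^-1.
Proof.
move=> Nx; move: y; apply: nat_ind => [||y Ny IH h]; first by defn.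
- by have := nat_ge0 Nx; move=> h h'; lra.
have := nat_ltS Nx Ny h; rewrite le_eqVlt => /orP[/eqP ->|/IH].
- by rewrite weightS.
- by rewrite weightS //; have := weight_gt0 Ny; move=> h1 h2; lra.
Qed.

Lemma weight_small (eps : K) : 0 < eps -> exists x, N x /\ weight x < eps.
Proof.
move=> he; apply: contrapT => no.
have ge x : N x -> eps <= weight x.
  by move=> Nx; rewrite leNgt; apply/negP => h; apply: no; exists x.
have [|||t [lb glb]] := @real_inf (fun y => exists x, N x /\ y = weight x);
  first by defn.
- by exists (weight 0), 0; split=> //; apply: nat0.
- by exists eps => y [x [Nx ->]]; apply: ge.
have t0 : eps <= t by apply: glb => y [x [Nx ->]]; apply: ge.
have : t * 3 <= t; last by lra.
apply: glb => y [x [Nx ->]].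
have : t <= weight (x + 1) by apply: lb; exists (x + 1); split=> //; apply: natS.
by rewrite weightS //; lra.
Qed.

(** * Coding sequences of reals by reals *)

(** The sequence of the partial sums of the weights of the elements of [D]. *)
Definition digit_sums (D : K -> Prop) (s : V) : Prop :=
  real_sequence s /\ value s 0 = 0 /\
  forall x, N x -> (D x /\ value s (x + 1) = value s x + weight x) \/
                   (~ D x /\ value s (x + 1) = value s x).

(** [c] is the supremum of the sequence [s]. *)
Definition least_bound (s : V) (c : K) : Prop :=
  (forall x, N x -> value s x <= c) /\
  forall d, (forall x, N x -> value s x <= d) -> c <= d.

Lemma digit_sums_ex D : definableR D -> exists s, digit_sums D s.
Proof.
move=> dD.
have [||s [h1 [h2 h3]]] := @recursive_sequence_ex 0 (fun x y z =>
  (D x /\ z = y + weight x) \/ (~ D x /\ z = y)).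
- by defn.
- move=> x y Nx; have [h|h] := pselect (D x).
  + by exists (y + weight x); split=> [|z]; [left|move=> [[_ ->]|[]]].
  + by exists y; split=> [|z]; [right|move=> [[]|[_ ->]]].
by exists s.
Qed.

Lemma digit_sums_mono D s x y : digit_sums D s -> N x -> N y -> x <= y ->
  value s x <= value s y.
Proof.
move=> [_ [_ hs]] Nx; move: y; apply: nat_ind => [||y Ny IH]; first by defn.
- by have := nat_ge0 Nx; move=> h h'; rewrite (_ : x = 0) //; lra.
rewrite le_eqVlt => /orP[/eqP -> //|/(nat_ltS Nx Ny) /IH h].
by have := weight_gt0 Ny; case: (hs y Ny) => -[_ ->] h'; lra.
Qed.

(** The tail of a series of weights is bounded by the geometric series. *)
Lemma digit_sums_tail D s x y : digit_sums D s -> N x -> N y -> x <= y ->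
  value s y + 3 / 2 * weight y <= value s x + 3 / 2 * weight x.
Proof.
move=> [_ [_ hs]] Nx; move: y; apply: nat_ind => [||y Ny IH]; first by defn.
- by have := nat_ge0 Nx; move=> h h'; rewrite (_ : x = 0) //; lra.
rewrite le_eqVlt => /orP[/eqP -> //|/(nat_ltS Nx Ny) /IH h].
by have := weight_gt0 Ny; rewrite weightS //; case: (hs y Ny) => -[_ ->] h'; lra.
Qed.

Lemma digit_sums_le D s x y : digit_sums D s -> N x -> N y ->
  value s y <= value s x + 3 / 2 * weight x.
Proof.
move=> hs Nx Ny; have := weight_gt0 Nx; have := weight_gt0 Ny.
have [yx|xy] := leP y x.
- by have := digit_sums_mono hs Ny Nx yx; move=> h1 h2 h3; lra.
- by have := digit_sums_tail hs Nx Ny (ltW xy); move=> h1 h2 h3; lra.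
Qed.

Lemma digit_sums_bound_ex D s : digit_sums D s -> exists c, least_bound s c.
Proof.
move=> hs.
have [|||c [h1 h2]] := @real_sup (fun y => exists x, N x /\ y = value s x).
- by defn.
- by exists (value s 0), 0; split=> //; apply: nat0.
- exists (value s 0 + 3 / 2 * weight 0) => y [x [Nx ->]].
  by apply: digit_sums_le hs _ _ => //; apply: nat0.
exists c; split=> [x Nx|d hd]; first by apply: h1; exists x.
by apply: h2 => y [x [Nx ->]]; apply: hd.
Qed.

Lemma digit_sums_bounds D s c : digit_sums D s -> least_bound s c ->
  0 <= c /\ c <= 3 / 2.
Proof.
move=> hs [h1 h2]; have s0 := proj1 (proj2 hs); split.
- by rewrite -s0; apply: h1; apply: nat0.
- apply: h2 => x Nx; have := digit_sums_le hs nat0 Nx.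
  by rewrite s0 weight0; lra.
Qed.

(** At the first difference of digits, the weight exceeds the whole tail. *)
Lemma digit_sums_lt D D' s s' c c' x : digit_sums D s -> digit_sums D' s' ->
  least_bound s c -> least_bound s' c' -> N x -> value s x = value s' x ->
  D x -> ~ D' x -> c' < c.
Proof.
move=> hs hs' [hc _] [_ hc'] Nx E Dx nDx; have w0 := weight_gt0 Nx.
have := hc (x + 1) (natS Nx).
have [[_ ->]|[]] := proj2 (proj2 hs) x Nx => // h1.
have : c' <= value s' (x + 1) + 3 / 2 * weight (x + 1).
  by apply: hc' => y Ny; apply: digit_sums_le hs' _ _ => //; apply: natS.
have [[] //|[_ ->]] := proj2 (proj2 hs') x Nx.
by rewrite weightS // => h2; lra.
Qed.

Lemma digit_sums_inj D D' s s' c : definableR D -> definableR D' ->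
  digit_sums D s -> digit_sums D' s' -> least_bound s c -> least_bound s' c ->
  forall x, N x -> D x <-> D' x.
Proof.
move=> dD dD' hs hs' hc hc' x0 Nx0; apply: contrapT => ne0.
have [||x [Nx [ne least]]] := @nat_least (fun x => ~ (D x <-> D' x)).
- by defn.
- by exists x0.
have E : forall y, N y -> y <= x -> value s y = value s' y.
  apply: nat_ind => [||y Ny IH yx]; first by defn.
  - by rewrite (proj1 (proj2 hs)) (proj1 (proj2 hs')).
  - have Ey : D y <-> D' y.
      by apply: contrapT => /(least y Ny) h; lra.
    have {}IH : value s y = value s' y by apply: IH; lra.
    have := proj2 (proj2 hs) y Ny; have := proj2 (proj2 hs') y Ny.
    by rewrite IH => -[[h ->]|[h ->]] [[h1 ->]|[h1 ->]] //; case: Ey; tauto.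
have Ex := E x Nx (lexx x).
have [Dx|nDx] := pselect (D x).
- have nD'x : ~ D' x by tauto.
  by have := digit_sums_lt hs hs' hc hc' Nx Ex Dx nD'x; rewrite ltxx.
- have D'x : D' x by apply: contrapT => h; apply: ne; tauto.
  by have := digit_sums_lt hs' hs hc' hc Nx (esym Ex) D'x nDx; rewrite ltxx.
Qed.

Lemma digit_sums_uniq D s s' c c' : digit_sums D s -> digit_sums D s' ->
  least_bound s c -> least_bound s' c' -> c = c'.
Proof.
move=> hs hs' [h1 h2] [h3 h4].
have E : forall x, N x -> value s x = value s' x.
  apply: nat_ind => [||x Nx IH]; first by defn.
  - by rewrite (proj1 (proj2 hs)) (proj1 (proj2 hs')).
  - have := proj2 (proj2 hs) x Nx; have := proj2 (proj2 hs') x Nx.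
    by rewrite IH => -[[h ->]|[h ->]] [[h5 ->]|[h5 ->]].
apply/eqP; rewrite eq_le; apply/andP; split.
- by apply: h2 => x Nx; rewrite E //; apply: h3.
- by apply: h4 => x Nx; rewrite -E //; apply: h1.
Qed.

(** An injective pairing of natural numbers: it lies between [(x + y) ^+ 2] and
    the next square. *)
Definition pairing (x y : K) : K := (x + y) * (x + y) + x.

Lemma rterm_pairing t u : rterm t -> rterm u -> rterm (fun e => pairing (t e) (u e)).
Proof. by move=> dt du; unfold pairing; defn. Qed.

Ltac defn_pairing := first [ simple apply rterm_pairing | defn_weight ].
Ltac defn_ext ::= defn_pairing.

Lemma nat_pairing x y : N x -> N y -> N (pairing x y).
Proof.
by move=> Nx Ny; apply: natD => //; apply: natM; apply: natD.
Qed.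

Lemma pairing_inj x y x' y' : N x -> N y -> N x' -> N y' ->
  pairing x y = pairing x' y' -> x = x' /\ y = y'.
Proof.
have key a b a' b' : N a -> N b -> N a' -> N b' -> a + b < a' + b' ->
    pairing a b <> pairing a' b'.
  move=> Na Nb Na' Nb' /(nat_lt_succ (natD Na Nb) (natD Na' Nb')).
  rewrite /pairing; have := nat_ge0 Na; have := nat_ge0 Nb; have := nat_ge0 Na'.
  move: (a' + b') => t h1 h2 h3 h4 h5.
  have : (a + b + 1) * (a + b + 1) <= t * t by apply: ler_pM; lra.
  by nra.
move=> Nx Ny Nx' Ny' E; have [h|h|h] := ltgtP (x + y) (x' + y').
- by case: (key x y x' y').
- by case: (key x' y' x y).
- by move: E; rewrite /pairing h => /addrI Ex; subst x'; move/addrI: h.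
Qed.

(** Distinct reals are separated by a fraction [(a - b) / (c + 1)]. *)
Lemma between (x y : K) : x < y -> exists a b c, N a /\ N b /\ N c /\
  b + x * (c + 1) <= a /\ a < b + y * (c + 1).
Proof.
move=> xy; have [c [Nc hc]] := archimedean (y - x)^-1.
have [b [Nb hb]] := archimedean (- (x * (c + 1))).
have hc1 : 1 <= (y - x) * (c + 1).
  have p : 0 < y - x by lra.
  by have := ler_wpM2l (ltW p) (ltW hc); rewrite mulfV ?gt_eqF // => h; lra.
have [||a [Na [ha least]]] := @nat_least (fun a => b + x * (c + 1) <= a).
- by defn.
- by have [a [Na ha]] := archimedean (b + x * (c + 1)); exists a; split=> //; lra.
exists a, b, c; do 4!split=> //.
have [a0|[a' [Na' aE]]] := nat_case Na; first by nra.
have : a' < b + x * (c + 1).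
  by rewrite ltNge; apply/negP => /(least _ Na'); lra.
by lra.
Qed.

(** The set of natural numbers that encodes the Dedekind cuts of all the terms
    of a sequence [f]: which fractions [(a - b) / (c + 1)] are less than
    [f i]. *)
Definition digits (f : V) (k : K) : Prop := exists a b c i,
  N a /\ N b /\ N c /\ N i /\ k = pairing (pairing a b) (pairing c i) /\
  a < b + value f i * (c + 1).

Lemma definable_digits : definableVR digits.
Proof. by unfold digits; defn. Qed.

Lemma digits_inj f f' : (forall k, N k -> digits f k <-> digits f' k) ->
  forall i, N i -> value f i = value f' i.
Proof.
have key g g' i : N i -> value g i < value g' i -> exists k, N k /\ digits g' k /\ ~ digits g k.
  move=> Ni /between [a [b [c [Na [Nb [Nc [h1 h2]]]]]]].
  exists (pairing (pairing a b) (pairing c i)); split.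
    by apply: nat_pairing; apply: nat_pairing.
  split; first by exists a, b, c, i; do 5!split=> //.
  move=> [a' [b' [c' [i' [Na' [Nb' [Nc' [Ni' [E h]]]]]]]]].
  have [E1 E2] := pairing_inj (nat_pairing Na Nb) (nat_pairing Nc Ni)
    (nat_pairing Na' Nb') (nat_pairing Nc' Ni') E.
  have [? ?] := pairing_inj Na Nb Na' Nb' E1.
  have [? ?] := pairing_inj Nc Ni Nc' Ni' E2; subst.
  by lra.
move=> H i Ni; have [h|h|//] := ltgtP (value f i) (value f' i).
- by have [k [Nk [h1 h2]]] := key _ _ _ Ni h; case: h2; apply/H.
- by have [k [Nk [h1 h2]]] := key _ _ _ Ni h; case: h2; apply/H.
Qed.

(** [code f c]: the real number [c] encodes the sequence of reals [f]. *)
Definition code (f : V) (c : K) : Prop :=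
  exists s, digit_sums (digits f) s /\ least_bound s c.

Lemma definable_code : definableVR code.
Proof.
have d := definable_digits.
by unfold code, digit_sums, least_bound, is_function; defn.
Qed.

Lemma code_ex f : exists c, code f c.
Proof.
have [|s hs] := @digit_sums_ex (digits f).
  by have d := definable_digits; unfold definableR; defn.
by have [c hc] := digit_sums_bound_ex hs; exists c, s.
Qed.

Lemma code_uniq f c c' : code f c -> code f c' -> c = c'.
Proof. by move=> [s [hs hc]] [s' [hs' hc']]; apply: digit_sums_uniq hs hs' hc hc'. Qed.

Lemma code_bounds f c : code f c -> 0 <= c /\ c <= 3 / 2.
Proof. by move=> [s [hs hc]]; apply: digit_sums_bounds hs hc. Qed.

Lemma code_inj f f' c : real_sequence f -> real_sequence f' ->
  code f c -> code f' c -> f = f'.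
Proof.
move=> hf hf' [s [hs hc]] [s' [hs' hc']]; apply: function_ext => //.
apply: digits_inj; apply: digit_sums_inj hs hs' hc hc'.
- by have d := definable_digits; unfold definableR; defn.
- by have d := definable_digits; unfold definableR; defn.
Qed.

(** * Countability *)

(** The recursion [0 |-> empty], [n + 1 |-> successor of the image of n]
    identifies [naturals] with omega. *)
Lemma nat_omega : exists w t, is_omega w /\ is_bijection t naturals w.
Proof.
have [w hw] := omega_ex; have [[[e [he hew]] hS] _] := hw.
have [||||t [ht [t0 tS]]] := @recursion_ex w e (fun _ y z => is_succ z y).
- by defn.
- exact: hew.
- by move=> _ y _ /hS [s [hs hsw]]; exists s.
- by move=> _ y z z' _ _ h h'; apply: ext => x; rewrite h h'.
have tS' x y s : N x -> Defs.rel t (v x) y -> is_succ s y -> Defs.rel t (v (x + 1)) s.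
  exact: tS.
have succ_of x y : N x -> Defs.rel t (v (x + 1)) y ->
    exists z, Defs.rel t (v x) z /\ is_succ y z.
  move=> Nx hy; have [z [hz hr]] := rel_ex ht Nx; have [s [hs _]] := hS z hz.
  exists z; split=> //.
  by rewrite (rel_uniq ht hy (tS' _ _ _ Nx hr hs)).
have not_zero x y : N x -> Defs.rel t (v (x + 1)) y -> is_empty y -> False.
  move=> Nx /(succ_of _ _ Nx) [z [_ hs]] hy; apply: (hy z); apply/hs.
  by right.
have inj : forall x, N x -> forall x' y, N x' -> Defs.rel t (v x) y ->
    Defs.rel t (v x') y -> x = x'.
  apply: nat_ind => [||x Nx IH]; first by defn.
  - move=> x' y /nat_case [-> //|[x1 [Nx1 ->]]] h0 h1.
    by case: (not_zero _ _ Nx1 h1); rewrite (rel_uniq ht h0 t0).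
  - move=> x' y /nat_case [->|[x1 [Nx1 ->]]] h0 h1.
      by case: (not_zero _ _ Nx h0); rewrite (rel_uniq ht h1 t0).
    have [z [hz hs]] := succ_of _ _ Nx h0; have [z' [hz' hs']] := succ_of _ _ Nx1 h1.
    by rewrite (succ_inj hs hs') in hz; rewrite (IH _ _ Nx1 hz hz').
exists w, t; split=> //; split=> //; split.
- move=> x x' y h h'.
  have [/naturals_val [z [Nz ?]] _] := rel_dom_cod ht h.
  have [/naturals_val [z' [Nz' ?]] _] := rel_dom_cod ht h'.
  by subst; rewrite (inj _ Nz _ _ Nz' h h').
- apply: (omega_ind hw) => [|x hx|y s _ [x hx] hs]; first by defn.
  + exists (v 0); rewrite (_ : x = e) //; apply: ext => y.
    by split=> hy; [case: (hx y)|case: (he y)].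
  + have [/naturals_val [z [Nz ?]] _] := rel_dom_cod ht hx; subst x.
    by exists (v (z + 1)); apply: tS' hx hs.
Qed.

Lemma countable_injection a : countable a -> exists h, is_function h a naturals /\
  forall x x' y, Defs.rel h x y -> Defs.rel h x' y -> x = x'.
Proof.
move=> [w [b [hw [hb [f [hf [finj _]]]]]]].
have [w' [t [hw' [ht [tinj tsurj]]]]] := nat_omega.
rewrite (omega_uniq hw' hw) in ht tsurj => {hw' w'}.
have [||h [hh hr]] := @function_ex _ _ a naturals
    (fun x y => exists n, Defs.rel f x n /\ Defs.rel t y n).
- by defn.
- move=> x hx; have [n [hn hxn]] := rel_ex hf hx.
  have [k hk] := tsurj n (hb n hn); have [Nk _] := rel_dom_cod ht hk.
  exists k; split; first by split=> //; exists n.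
  move=> k' [_ [n' [hn' hk']]]; rewrite (rel_uniq hf hn' hxn) in hk'.
  exact: tinj hk hk'.
exists h; split=> // x x' y /hr [_ [_ [n [h1 h2]]]] /hr [_ [_ [n' [h3 h4]]]].
by rewrite (rel_uniq ht h4 h2) in h3; apply: finj h1 h3.
Qed.

(** The reals that satisfy [P] can be labelled by natural numbers, injectively,
    although a given real may have several labels. *)
Definition labelled (P : K -> Prop) : Prop := exists h,
  (forall x, P x -> exists k, N k /\ Defs.rel h (v x) (v k)) /\
  forall x x' k, P x -> P x' -> N k -> Defs.rel h (v x) (v k) ->
    Defs.rel h (v x') (v k) -> x = x'.

Lemma real_relation_ex (G : K -> K -> Prop) : definableRR G ->
  exists h, forall x k, N k -> Defs.rel h (v x) (v k) <-> G x k.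
Proof.
move=> dG; have [|h [_ hh]] := @relation_ex _ _ R naturals
  (fun x y => G (real_of x) (real_of y)); first by defn.
exists h => x k Nk; rewrite hh !real_ofK; split=> [[_ []]|] //.
by move=> h1; split; first exact: (val_mem hK).
Qed.

Lemma countable_labelled a : subset a R -> countable a -> labelled (fun x => mem (v x) a).
Proof.
move=> ha /countable_injection [h [hh inj]]; exists h; split.
- move=> x hx; have [y [Ny hr]] := rel_ex hh hx.
  by have [k [Nk ?]] := naturals_val Ny; subst y; exists k.
- by move=> x x' k _ _ _ h1 h2; apply: (val_inj hK); apply: inj h1 h2.
Qed.

Lemma labelled_countable a : subset a R -> labelled (fun x => mem (v x) a) -> countable a.
Proof.
move=> ha [h [hex hinj]].
have [w [t [hw [ht [tinj tsurj]]]]] := nat_omega.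
pose first x k := N k /\ Defs.rel h x (v k) /\
  forall k', N k' -> Defs.rel h x (v k') -> k <= k'.
have [||f [hf hr]] := @function_ex _ _ a w
    (fun x n => exists k, first x k /\ Defs.rel t (v k) n).
- by unfold first; defn.
- move=> x hx; have [y ?] := val_surj hK (ha x hx); subst x.
  have [||k [Nk [hk least]]] := @nat_least (fun k => Defs.rel h (v y) (v k)).
  + by defn.
  + exact: hex.
  have [n [hn hkn]] := rel_ex ht Nk.
  exists n; split; first by split=> //; exists k.
  move=> n' [_ [k' [[Nk' [hk' least']] hkn']]].
  have E : k = k' by apply/eqP; rewrite eq_le least // least'.
  by subst k'; apply: rel_uniq ht hkn hkn'.
have finj x x' y : Defs.rel f x y -> Defs.rel f x' y -> x = x'.
  move=> /hr [hx [_ [k [[Nk [h1 _]] h2]]]] /hr [hx' [_ [k' [[Nk' [h3 _]] h4]]]].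
  have [z ?] := val_surj hK (ha x hx); have [z' ?] := val_surj hK (ha x' hx'); subst.
  have E := tinj _ _ _ h4 h2; rewrite E in h3.
  by rewrite (hinj _ _ _ hx hx' Nk h1 h3).
have [|b hb] := @separation _ _ (fun y => exists x, Defs.rel f x y) w; first by defn.
exists w, b; split=> //; split; first by move=> y /hb [].
exists f; split; last by split=> // y /hb [].
split=> [p hp|]; last by case: hf.
have [x [y [hx [hy hxy]]]] := proj1 hf p hp; exists x, y; split=> //; split=> //.
by apply/hb; split=> //; exists x, p.
Qed.

Lemma labelled_sub (P Q : K -> Prop) : (forall x, P x -> Q x) -> labelled Q -> labelled P.
Proof.
move=> h [f [hex inj]]; exists f; split=> [x /h /hex //|x x' k /h hx /h hx'].
exact: inj.
Qed.

Lemma labelled_unique (P : K -> Prop) : (forall x y, P x -> P y -> x = y) -> labelled P.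
Proof.
move=> h; have [|f hf] := @real_relation_ex (fun _ _ => True); first by defn.
exists f; split=> [x _|x x' k Px Px' _ _ _]; last exact: h.
by exists 0; split; [apply: nat0|apply/hf => //; apply: nat0].
Qed.

(** A set whose elements are determined by the elements of two labelled sets
    is labelled. *)
Lemma labelled_pair (P Q S : K -> Prop) (T : K -> K -> K -> Prop) :
  definableR P -> definableR Q ->
  definable (fun e => T (real_of (e 0)) (real_of (e 1)) (real_of (e 2))) ->
  labelled P -> labelled Q ->
  (forall z, S z -> exists x y, P x /\ Q y /\ T z x y) ->
  (forall z z' x y, T z x y -> T z' x y -> z = z') ->
  labelled S.
Proof.
move=> dP dQ dT [f [fex finj]] [g [gex ginj]] Sex Tinj.
have dT' t u w : rterm t -> rterm u -> rterm w -> definable (fun e => T (t e) (u e) (w e)).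
  move=> dt du dw.
  apply: (@definable_ext _ (fun e =>
    T (real_of (v (t e))) (real_of (v (u e))) (real_of (v (w e))))).
    by move=> e; rewrite !real_ofK.
  exact: (@definable_app3 _ (fun x y z => T (real_of x) (real_of y) (real_of z))).
have [|h hh] := @real_relation_ex (fun z k => exists x y i j,
  P x /\ Q y /\ T z x y /\ N i /\ N j /\ Defs.rel f (v x) (v i) /\
  Defs.rel g (v y) (v j) /\ k = pairing i j).
  by defn; apply: dT'; defn.
exists h; split.
- move=> z /Sex [x [y [Px [Qy Tz]]]].
  have [i [Ni hi]] := fex x Px; have [j [Nj hj]] := gex y Qy.
  exists (pairing i j); have Nk := nat_pairing Ni Nj; split=> //; apply/hh => //.
  by exists x, y, i, j.
- move=> z z' k _ _ Nk /(hh _ _ Nk) [x [y [i [j [Px [Qy [Tz [Ni [Nj [hi [hj hk]]]]]]]]]]].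
  move=> /(hh _ _ Nk) [x' [y' [i' [j' [Px' [Qy' [Tz' [Ni' [Nj' [hi' [hj' hk']]]]]]]]]]].
  rewrite hk' in hk; have [? ?] := pairing_inj Ni' Nj' Ni Nj hk; subst i' j'.
  rewrite -(finj _ _ _ Px Px' Ni hi hi') -(ginj _ _ _ Qy Qy' Nj hj hj') in Tz'.
  exact: Tinj Tz Tz'.
Qed.

Lemma labelled_or (P Q : K -> Prop) : definableR P -> definableR Q ->
  labelled P -> labelled Q -> labelled (fun x => P x \/ Q x).
Proof.
move=> dP dQ [f [fex finj]] [g [gex ginj]].
have [|h hh] := @real_relation_ex (fun z k => 
  (P z /\ exists i, N i /\ Defs.rel f (v z) (v i) /\ k = pairing i 0) \/
  (Q z /\ exists i, N i /\ Defs.rel g (v z) (v i) /\ k = pairing i 1)).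
  by defn.
have N1 : N 1 by have := natS nat0; rewrite add0r.
have ne i j : N i -> N j -> pairing i 0 = pairing j 1 -> False.
  by move=> Ni Nj /(pairing_inj Ni nat0 Nj N1) [_]; lra.
exists h; split.
- move=> z [Pz|Qz].
  + have [i [Ni hi]] := fex z Pz; exists (pairing i 0).
    have Nk := nat_pairing Ni nat0; split=> //; apply/hh => //.
    by left; split=> //; exists i.
  + have [i [Ni hi]] := gex z Qz; exists (pairing i 1).
    have Nk := nat_pairing Ni N1; split=> //; apply/hh => //.
    by right; split=> //; exists i.
- move=> z z' k _ _ Nk /(hh _ _ Nk) [|] [Pz [i [Ni [hi hk]]]];
    move=> /(hh _ _ Nk) [|] [Pz' [i' [Ni' [hi' hk']]]]; rewrite hk in hk'.
  + have [? _] := pairing_inj Ni nat0 Ni' nat0 hk'; subst i'.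
    exact: finj hi hi'.
  + by case: (ne i i').
  + by case: (ne i' i).
  + have [? _] := pairing_inj Ni N1 Ni' N1 hk'; subst i'.
    exact: ginj hi hi'.
Qed.

(** * The topology of a subspace of the reals *)

Section Subspace.
Variable TR : V.
Hypothesis hTR : is_standard_topology R lt TR.

Lemma subspace_topology_ex X : exists T, is_subspace_topology TR X T.
Proof.
have [P hP] := zf_power hV X.
have [|T hT] := @separation _ _ (fun O => exists U, mem U TR /\ is_inter O U X) P.
  by defn.
exists T => O; rewrite hT; split=> [[] //|h]; split=> //; apply/hP => x.
by have [U [_ hU]] := h => /hU [].
Qed.

Variables X T : V.
Hypothesis hX : subset X R.
Hypothesis hT : is_subspace_topology TR X T.

(** [P] contains an open interval around each of its elements. *)
Definition open_pred (P : K -> Prop) : Prop :=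
  forall x, P x -> exists a b, a < x /\ x < b /\ forall y, a < y -> y < b -> P y.

Lemma subspace_open O x : mem O T -> mem (v x) O -> exists a b, a < x /\ x < b /\
  forall y, a < y -> y < b -> mem (v y) X -> mem (v y) O.
Proof.
move=> /hT [U [/hTR [UR hU] hO]] /hO [/hU [a [b [ax [xb h]]]] _].
have [p [hp hpl]] := ax; have [q [hq hql]] := xb.
have [a' [x' [ha [_ hp']]]] := reals_lt hR hpl.
have [x'' [b' [_ [hb hq']]]] := reals_lt hR hql.
have [? _] := opair_inj hp hp'; have [_ ?] := opair_inj hq hq'; subst a' b'.
have [a1 ?] := val_surj hK ha; have [b1 ?] := val_surj hK hb; subst a b.
exists a1, b1; split; first exact/(val_lt hK); split; first exact/(val_lt hK).
by move=> y ay yb Xy; apply/hO; split=> //; apply: h; apply/(val_lt hK).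
Qed.

Lemma subspace_open_ex P : definableR P -> open_pred P ->
  exists O, mem O T /\ forall x, mem x O <-> mem x X /\ P (real_of x).
Proof.
move=> dP oP; have [U [UR hU]] := real_set_ex dP.
have [O hO] := @separation _ _ (fun x => P (real_of x)) X dP.
exists O; split=> //; apply/hT; exists U; split.
  apply/hTR; split=> // x hx; have [y ?] := val_surj hK (UR x hx); subst x.
  have [a [b [ay [yb h]]]] := oP y (proj1 (hU y) hx).
  exists (v a), (v b); split; first exact/(val_lt hK); split; first exact/(val_lt hK).
  move=> z [p [hp hpl]] [q [hq hql]].
  have [a' [z' [_ [hz hp']]]] := reals_lt hR hpl.
  have [_ ?] := opair_inj hp hp'; subst z'.
  have [z1 ?] := val_surj hK hz; subst z; apply/hU.
  by apply: h; apply/(val_lt hK); [exists p|exists q].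
move=> x; rewrite hO; split=> [[Xx Px]|[Ux Xx]]; split=> //.
- by have [y ?] := val_surj hK (hX Xx); subst x; apply/hU; rewrite real_ofK in Px.
- by have [y ?] := val_surj hK (hX Xx); subst x; rewrite real_ofK; apply/hU.
Qed.

Lemma closed_inP C : subset C X -> closed_in X T C <->
  forall x, mem (v x) X -> ~ mem (v x) C ->
    exists a b, a < x /\ x < b /\ forall y, a < y -> y < b -> ~ mem (v y) C.
Proof.
move=> CX; split.
- move=> [_ [O [hO OX]]] x Xx nCx.
  have [|a [b [ax [xb h]]]] := subspace_open (x := x) hO; first by apply/OX.
  exists a, b; split=> //; split=> // y ay yb Cy.
  by have /OX [_] := h y ay yb (CX _ Cy); apply.
- move=> h; split=> //.
  have [||O [hO hOX]] := @subspace_open_ex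
    (fun x => exists a b, a < x /\ x < b /\ forall y, a < y -> y < b -> ~ mem (v y) C).
  + by defn.
  + by move=> x [a [b [ax [xb hab]]]]; exists a, b; split=> //; split=> // y ay yb; exists a, b.
  exists O; split=> // x; rewrite hOX.
  split=> -[Xx hx]; split=> //; have [y ?] := val_surj hK (hX Xx); subst x.
  + by move: hx; rewrite real_ofK => -[a [b [ay [yb hab]]]]; apply: hab.
  + by rewrite real_ofK; apply: h.
Qed.

(** A compact set that is covered by a chain of open sets is contained in one of
    them. *)
Lemma compact_chain C (Y : K -> Prop) (O : K -> K -> Prop) :
  compact_in X T C -> nonempty C -> definableR Y -> definableRR O ->
  (forall y, Y y -> open_pred (O y)) ->
  (forall y y' x, Y y -> Y y' -> y <= y' -> O y' x -> O y x) ->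
  (forall x, mem (v x) C -> exists y, Y y /\ O y x) ->
  exists y, Y y /\ forall x, mem (v x) C -> O y x.
Proof.
move=> [CX hC] [c0 hc0] dY dO oO chain cover.
have [|U hU] := @separation _ _ (fun o => exists y, Y y /\
  forall x, mem x o <-> mem x X /\ O y (real_of x)) T; first by defn.
have [||W [WU [Wfin Wcov]]] := hC U.
- by move=> o /hU [].
- move=> x hx; have [z ?] := val_surj hK (hX (CX x hx)); subst x.
  have [y [Yy Oyz]] := cover z hx.
  have [||o [oT ho]] := @subspace_open_ex (O y); first by defn.
    exact: oO.
  exists o; split; first by apply/hU; split=> //; exists y.
  by apply/ho; rewrite real_ofK; split=> //; apply: CX.
have [|||||o [oW omax]] := @finite_least _ _ W (fun a b => subset b a).
- by defn.
- move=> a b /WU /hU [_ [y [Yy ha]]] /WU /hU [_ [y' [Yy' hb]]].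
  have [yy'|/ltW yy'] := leP y y'.
  + by left=> x /hb [Xx Ox]; apply/ha; split=> //; apply: chain Ox.
  + by right=> x /ha [Xx Ox]; apply/hb; split=> //; apply: chain Ox.
- by move=> a b c ab bc x /bc /ab.
- by [].
- by have [o [oW _]] := Wcov c0 hc0; exists o.
have /WU /hU [_ [y [Yy hy]]] := oW.
exists y; split=> // x /Wcov [o' [o'W ho']].
by have /hy [_] := omax o' o'W _ ho'; rewrite real_ofK.
Qed.

(** The left-to-right minima of an enumeration of a set [S] of reals that does
    not contain its infimum form an infinite set; the infimum is the only
    possible accumulation point of that set. *)
Lemma infinite_closed_ex (S : K -> Prop) (z0 : K) :
  definableR S -> labelled S -> (exists x, S x) -> (forall x, S x -> mem (v x) X) ->
  (forall x, S x -> z0 <= x) -> (forall c, (forall x, S x -> c <= x) -> c <= z0) ->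
  ~ mem (v z0) X ->
  exists C, (forall x, mem x C -> mem x R /\ S (real_of x)) /\ infinite C /\ closed_in X T C.
Proof.
move=> dS [h [hex hinj]] [x0 Sx0] SX lb glb nX.
(* [rec x k]: [x] has label [k] and is less than all elements of smaller label. *)
pose lab x k := N k /\ Defs.rel h (v x) (v k).
pose rec x k := S x /\ lab x k /\ forall x' k', S x' -> lab x' k' -> k' < k -> x < x'.
have [|C [CR hC]] := @real_set_ex (fun x => exists k, rec x k).
  by unfold rec, lab; defn.
have rec_lt x x' k k' : rec x k -> rec x' k' -> k < k' -> x' < x.
  by move=> [Sx [lx _]] [_ [_ h']] kk'; apply: h' Sx lx kk'.
have rec_eq x x' k : rec x k -> rec x' k -> x = x'.
  by move=> [Sx [[Nk lx] _]] [Sx' [[_ lx'] _]]; apply: hinj lx lx'.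
have small x : z0 < x -> exists y k, y < x /\ rec y k.
  move=> zx; have [y [Sy yx]] : exists y, S y /\ y < x.
    apply: contrapT => no; suff : x <= z0 by lra.
    by apply: glb => y Sy; rewrite leNgt; apply/negP => yx; apply: no; exists y.
  have [||k [Nk [[y1 [Sy1 [y1x ly1]]] least]]] :=
    @nat_least (fun k => exists y, S y /\ y < x /\ lab y k).
  - by unfold lab; defn.
  - by have [k [Nk hk]] := hex y Sy; exists k; split=> //; exists y.
  exists y1, k; split=> //; split=> //; split=> // x' k' Sx' lx' k'k.
  rewrite ltNge; apply/negP => x'y1.
  suff : k <= k' by lra.
  apply: least; first by case: lx'.
  by exists x'; split=> //; split=> //; lra.
have Sgt x : S x -> z0 < x.
  by move=> Sx; rewrite lt_neqAle lb // andbT; apply/eqP => E; apply: nX; rewrite E; apply: SX.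
have CX : subset C X.
  move=> x Cx; have [y ?] := val_surj hK (CR x Cx); subst x.
  by have /hC [k [Sy _]] := Cx; apply: SX.
exists C; split; last split.
- move=> x Cx; split; first exact: CR.
  have [y ?] := val_surj hK (CR x Cx); subst x; rewrite real_ofK.
  by have /hC [k []] := Cx.
- move=> fin.
  have Cne : nonempty C.
    by have [y [k [_ hy]]] := small x0 (Sgt _ Sx0); exists (v y); apply/hC; exists k.
  have [|||x [Cx hx]] := @finite_least _ _ C (fun x y => real_of x <= real_of y) _ _ _ fin Cne.
  + by defn.
  + by move=> x y _ _; apply/orP; apply: le_total.
  + by move=> x y z; apply: le_trans.
  have [x1 ?] := val_surj hK (CR x Cx); subst x.
  have /hC [k [Sx1 _]] := Cx.
  have [y [k' [yx hy]]] := small x1 (Sgt _ Sx1).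
  have := hx (v y); rewrite !real_ofK leNgt yx => /(_ _) h1.
  by suff : false by []; apply: h1; apply/hC; exists k'.
- apply/(closed_inP CX) => p Xp nCp.
  have [pz|zp|E] := ltgtP p z0; last by case: nX; rewrite -E.
    exists (p - 1), z0; split; first by lra.
    by split=> // y _ yz /hC [k [Sy _]]; have := lb y Sy; lra.
  have ne y : (exists k, rec y k) -> y <> p by move=> hy E; apply: nCp; apply/hC; subst p.
  have [s [k [sp hs]]] := small p zp.
  (* The least label of a minimum below [p] is that of the greatest one. *)
  have [||k1 [Nk1 [[s1 [s1p hs1]] least1]]] := @nat_least (fun k => exists y, y < p /\ rec y k).
  + by unfold rec, lab; defn.
  + by exists k; split; [case: hs => _ [[]]|exists s].
  have below y : (exists k, rec y k) -> y < p -> y <= s1.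
    move=> [k2 hy] yp; have [k21|k12|E] := ltgtP k2 k1.
    * have Nk2 : N k2 by case: hy => _ [[]].
      by have : k1 <= k2; [apply: least1 => //; exists y|lra].
    * by apply: ltW; apply: rec_lt hs1 hy k12.
    * by subst k2; rewrite (rec_eq _ _ _ hs1 hy).
  have [[y0 [k0 [py0 hy0]]]|none] := pselect (exists y k, p < y /\ rec y k).
    have [||||k2 [Nk2 [[s2 [ps2 hs2]] greatest2]]] :=
      @nat_greatest (fun k => exists y, p < y /\ rec y k) k1.
    + by unfold rec, lab; defn.
    + by exists k0; split; [case: hy0 => _ [[]]|exists y0].
    + by [].
    + move=> k2 Nk2 [y [py hy]]; rewrite leNgt; apply/negP => k12.
      by have := rec_lt _ _ _ _ hs1 hy k12; lra.
    exists s1, s2; split=> //; split=> // y s1y ys2 /hC hy.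
    have [yp|py|E] := ltgtP y p; last by apply: ne hy E.
      by have := below y hy yp; lra.
    have [k3 hy3] := hy; have Nk3 : N k3 by case: hy3 => _ [[]].
    have := greatest2 k3 Nk3 (ex_intro _ y (conj py hy3)).
    rewrite le_eqVlt => /orP[/eqP E|k32].
      by subst k3; have := rec_eq _ _ _ hs2 hy3; lra.
    by have := rec_lt _ _ _ _ hy3 hs2 k32; lra.
  exists s1, (p + 1); split=> //; split; first by lra.
  move=> y s1y _ /hC hy; have [yp|py|E] := ltgtP y p; last by apply: ne hy E.
    by have := below y hy yp; lra.
  by apply: none; have [k3 hy3] := hy; exists y, k3.
Qed.

End Subspace.

(** * Selections and blocks *)

Section Family.
Variable A : K -> K -> Prop.
Hypothesis dA : definableRR A.
Hypothesis A_nonempty : forall i, N i -> exists y, A i y.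

(** [f] represents a finite sequence, of length [n], of elements of the
    first [n] sets of the family; it is padded with zeros. *)
Definition selection (n : K) (f : V) : Prop :=
  real_sequence f /\ forall i, N i ->
    (i < n -> A i (value f i)) /\ (n <= i -> value f i = 0).

Lemma definable_selection : definableRV selection.
Proof. by unfold selection, is_function; defn. Qed.

(** [g] agrees with [f], except that its value at [n] is [y]. *)
Definition update (f g : V) (n y : K) : Prop :=
  value g n = y /\ forall i, N i -> i <> n -> value g i = value f i.

Lemma update_ex f n y : N n -> exists g, real_sequence g /\ update f g n y.
Proof.
move=> Nn; have [||g [hg hgE]] := @sequence_ex (fun i z =>
  (i = n /\ z = y) \/ (i <> n /\ z = value f i)).
- by defn.
- move=> i Ni; have [->|ne] := pselect (i = n).
  + by exists y; split=> [|z [[]|[]]] //; left.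
  + by exists (value f i); split=> [|z [[]|[]]] //; right.
exists g; split=> //; split=> [|i Ni ne]; first by case: (hgE n Nn) => -[].
by case: (hgE i Ni) => -[].
Qed.

Lemma selection0 f : real_sequence f -> (forall i, N i -> value f i = 0) -> selection 0 f.
Proof.
move=> hf f0; split=> // i Ni; split; last by move=> _; apply: f0.
by have := nat_ge0 Ni; move=> h h'; lra.
Qed.

Lemma selectionS n f g y : N n -> selection n f -> real_sequence g -> A n y ->
  update f g n y -> selection (n + 1) g.
Proof.
move=> Nn [_ hf] hg Ay [gn gE]; split=> // i Ni; split.
- move=> /(nat_ltS Ni Nn); rewrite le_eqVlt => /orP[/eqP ->|lt_in]; first by rewrite gn.
  rewrite gE //; first by apply: (proj1 (hf i Ni)).
  by move=> E; lra.
- by move=> h; rewrite gE //; [apply: (proj2 (hf i Ni)); lra|move=> E; lra].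
Qed.

Lemma selection_restrict n f g : N n -> selection (n + 1) f -> real_sequence g ->
  update f g n 0 -> selection n g.
Proof.
move=> Nn [_ hf] hg [gn gE]; split=> // i Ni; split.
- by move=> h; rewrite gE //; [apply: (proj1 (hf i Ni)); lra|move=> E; lra].
- rewrite le_eqVlt => /orP[/eqP <- //|h]; rewrite gE //; last by move=> E; lra.
  by apply: (proj2 (hf i Ni)); apply: nat_lt_succ.
Qed.

Lemma selection_ex n : N n -> exists f, selection n f.
Proof.
have dS := definable_selection.
move: n; apply: nat_ind => [||n Nn [f hf]]; first by defn.
- have [||f [hf f0]] := @sequence_ex (fun _ y => y = 0); first by defn.
    by move=> x _; exists 0; split.
  by exists f; apply: selection0.
- have [y hy] := A_nonempty Nn; have [g [hg hfg]] := update_ex f y Nn.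
  by exists g; apply: selectionS hy hfg.
Qed.

(** The codes of the selections of length [n]. *)
Definition codes (n c : K) : Prop := exists f, selection n f /\ code f c.

Lemma definable_codes : definableRR codes.
Proof.
have dS := definable_selection; have dC := definable_code.
by unfold codes; defn.
Qed.

(** By induction on [n], as a selection of length [n + 1] is a selection of
    length [n] with an additional element; no choice of labellings for the
    [A i] is needed. *)
Lemma labelled_codes : (forall i, N i -> labelled (A i)) ->
  forall n, N n -> labelled (codes n).
Proof.
move=> hA; have dS := definable_selection; have dC := definable_code.
have dc := definable_codes.
apply: nat_ind => [||n Nn IH]; first by unfold labelled; defn.
- apply: labelled_unique => x y [f [[hf f0] hx]] [g [[hg g0] hy]].
  suff E : f = g by subst g; apply: code_uniq hx hy.
  apply: function_ext => // i Ni.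
  by rewrite (proj2 (f0 i Ni)) ?(proj2 (g0 i Ni)) //; apply: nat_ge0.
- apply: (@labelled_pair (codes n) (A n) _ (fun z x y => exists f g,
    selection (n + 1) f /\ code f z /\ selection n g /\ code g x /\
    (forall i, N i -> i <> n -> value g i = value f i) /\ value f n = y)) => //.
  + by defn.
  + by defn.
  + by defn.
  + exact: hA.
  + move=> z [f [hf hz]]; have [g [hg hfg]] := update_ex f 0 Nn.
    have [x hx] := code_ex g; exists x, (value f n).
    have hsel := selection_restrict Nn hf hg hfg.
    split; first by exists g.
    split; first by apply: (proj1 (proj2 hf n Nn)); lra.
    by exists f, g; do 4!split=> //; case: hfg.
  + move=> z z' x y [f [g [hf [hz [hg [hx [E hy]]]]]]] [f' [g' [hf' [hz' [hg' [hx' [E' hy']]]]]]].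
    have Eg := code_inj (proj1 hg) (proj1 hg') hx hx'; subst g'.
    suff Ef : f = f' by subst f'; apply: code_uniq hz hz'.
    apply: function_ext (proj1 hf) (proj1 hf') _ => i Ni.
    have [->|ne] := pselect (i = n); first by rewrite hy hy'.
    by rewrite -E // E'.
Qed.

(** The [n]-th block: the codes of the selections of length [n], moved into the
    interval from [weight n] to [5/2 * weight n]. *)
Definition block (n z : K) : Prop := exists c, codes n c /\ z = weight n * (1 + c).

Lemma definable_block : definableRR block.
Proof. by have d := definable_codes; unfold block; defn. Qed.

Lemma block_nonempty n : N n -> exists z, block n z.
Proof.
move=> /selection_ex [f hf]; have [c hc] := code_ex f.
by exists (weight n * (1 + c)), c; split=> //; exists f.
Qed.

Lemma block_bounds n z : N n -> block n z -> weight n <= z /\ z <= weight n * (5 / 2).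
Proof.
move=> Nn [c [[f [_ /code_bounds [c0 c1]]] ->]]; have := weight_gt0 Nn.
by move=> w0; split; nra.
Qed.

Lemma block_gt0 n z : N n -> block n z -> 0 < z.
Proof. by move=> Nn /(block_bounds Nn) [h _]; apply: lt_le_trans h; apply: weight_gt0. Qed.

Lemma block_disjoint m n z : N m -> N n -> block m z ->
  weight n <= z -> z <= weight n * (5 / 2) -> m = n.
Proof.
move=> Nm Nn /(block_bounds Nm) [h1 h2] h3 h4.
have wm := weight_gt0 Nm; have wn := weight_gt0 Nn.
have [h|h|//] := ltgtP m n.
- by have := weight_lt Nm Nn h; lra.
- by have := weight_lt Nn Nm h; lra.
Qed.

Lemma block_small n (eps : K) : 0 < eps -> exists m, N m /\ n < m /\ weight m * (5 / 2) < eps.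
Proof.
move=> he; have [p [Np hp]] := archimedean n.
have [q [Nq hq]] : exists q, N q /\ weight q < eps * (2 / 5) by apply: weight_small; lra.
exists (p + q + 1).
have Np1 : N (p + q + 1) by apply: natS; apply: natD.
have p0 := nat_ge0 Np; have q0 := nat_ge0 Nq; split=> //; split; first by lra.
have : weight (p + q + 1) <= weight q * 3^-1 by apply: weight_lt => //; lra.
by have := weight_gt0 Nq; lra.
Qed.

Lemma labelled_block : (forall i, N i -> labelled (A i)) ->
  forall n, N n -> labelled (block n).
Proof.
move=> hA n Nn; have dc := definable_codes.
apply: (@labelled_pair (codes n) (fun y => y = 0) _ (fun z x _ => z = weight n * (1 + x))).
- by defn.
- by defn.
- by defn.
- exact: labelled_codes.
- by apply: labelled_unique => x y -> ->.
- by move=> z [c [hc ->]]; exists c, 0.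
- by move=> z z' x _ -> ->.
Qed.

(** A single-valued definable choice from infinitely many blocks gives a choice
    from the whole family: an element of the [n]-th block decodes to elements
    of the first [n] sets. *)
Lemma partial_choice (H : K -> K -> Prop) : definableRR H ->
  (forall n z z', H n z -> H n z' -> z = z') ->
  (forall n, N n -> exists m z, N m /\ n < m /\ H m z /\ block m z) ->
  exists f, real_sequence f /\ forall i, N i -> A i (value f i).
Proof.
move=> dH Huniq Hex.
have dS := definable_selection; have dC := definable_code.
have dB := definable_block.
(* The first block after the [i]-th one from which there is a choice is used. *)
pose good i m := N m /\ i < m /\ exists z, H m z /\ block m z.
pose dec i y m := good i m /\ (forall m', good i m' -> m <= m') /\
  exists f c, selection m f /\ code f c /\ H m (weight m * (1 + c)) /\ y = value f i.
have [||f [hf hfi]] := @sequence_ex (fun i y => exists m, dec i y m).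
- by unfold dec, good; defn.
- move=> i Ni.
  have [||m [Nm [gm least]]] := @nat_least (good i).
  + by unfold good; defn.
  + have [m [z [Nm [im hz]]]] := Hex i Ni.
    by exists m; split=> //; split=> //; split=> //; exists z.
  have [_ [im [z [Hz [c [[f [hf hc]] Ez]]]]]] := gm.
  exists (value f i); split.
    exists m; split=> //; split; first by move=> m' gm'; apply: least => //; case: gm'.
    by exists f, c; rewrite -Ez.
  move=> y [m' [gm' [least' [f' [c' [hf' [hc' [Hz' ->]]]]]]]].
  have E : m = m' by apply/eqP; rewrite eq_le least' // least //; case: gm'.
  subst m'; have := Huniq _ _ _ Hz Hz'; rewrite Ez => /mulfI.
  rewrite gt_eqF ?weight_gt0 // => /(_ isT) /addrI Ec; subst c'.
  by rewrite (code_inj (proj1 hf) (proj1 hf') hc hc').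
exists f; split=> // i Ni.
have [m [[Nm [im _]] [_ [g [c [hg [hc [_ ->]]]]]]]] := hfi i Ni.
exact: (proj1 (proj2 hg i Ni)).
Qed.

(** * The space of all the blocks *)

Section Space.
Variable TR : V.
Hypothesis hTR : is_standard_topology R lt TR.
Variables X T : V.
Hypothesis hX : subset X R.
Hypothesis hT : is_subspace_topology TR X T.
Hypothesis XE : forall z, mem (v z) X <-> z = 0 \/ exists n, N n /\ block n z.
Hypothesis no_choice : ~ exists f, real_sequence f /\ forall i, N i -> A i (value f i).

Lemma space_block n z : N n -> block n z -> mem (v z) X.
Proof. by move=> Nn hz; apply/XE; right; exists n. Qed.

(** The blocks being disjoint, [block n] is cut out of the space by a closed
    interval. *)
Lemma block_gap n x : N n -> mem (v x) X -> ~ block n x ->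
  x < weight n \/ weight n * (5 / 2) < x.
Proof.
move=> Nn /XE [->|[m [Nm hx]]] nx; first by left; apply: weight_gt0.
have [h|h] := ltP x (weight n); [by left|right].
rewrite ltNge; apply/negP => h'; apply: nx.
by rewrite -(block_disjoint Nm Nn hx h h').
Qed.

Lemma space_not_loeb : ~ loeb X T.
Proof.
move=> [F [hF [phi [u [hphi hsel]]]]]; apply: no_choice.
have dB := definable_block.
pose H n z := exists c, subset c R /\ (forall y, mem (v y) c <-> block n y) /\
  Defs.rel phi c (v z).
apply: (@partial_choice H).
- by unfold H; defn.
- move=> n z z' [c [cR [hc hz]]] [c' [c'R [hc' hz']]].
  suff E : c = c' by subst c'; apply: (val_inj hK); apply: rel_uniq hphi hz hz'.
  apply: ext => x; split=> hx.
  + by have [y ?] := val_surj hK (cR x hx); subst x; apply/hc'/hc.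
  + by have [y ?] := val_surj hK (c'R x hx); subst x; apply/hc/hc'.
- move=> n Nn; have Nn1 := natS Nn; exists (n + 1).
  have [|c [cR hc]] := @real_set_ex (block (n + 1)); first by defn.
  have cX : subset c X.
    move=> x hx; have [y ?] := val_surj hK (cR x hx); subst x.
    by apply: (space_block Nn1); apply/hc.
  have cF : mem c F.
    apply/hF; split; last by have [z hz] := block_nonempty Nn1; exists (v z); apply/hc.
    apply/(closed_inP hTR hX hT cX) => x Xx ncx.
    have [|h|h] := block_gap Nn1 Xx; first by move=> hx; apply: ncx; apply/hc.
    + exists (x - 1), (weight (n + 1)); split; first by lra.
      by split=> // y _ yw /hc /(block_bounds Nn1) [h1 _]; lra.
    + exists (weight (n + 1) * (5 / 2)), (x + 1); split=> //; split; first by lra.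
      by move=> y wy _ /hc /(block_bounds Nn1) [_ h1]; lra.
  have [y [_ hy]] := rel_ex hphi cF; have hyc := hsel _ _ cF hy.
  have [z ?] := val_surj hK (cR y hyc); subst y; exists z.
  split=> //; split; first by lra.
  by split; [exists c|apply/hc].
Qed.

(** A compact set meets only boundedly many blocks, as its intersection with a
    block has a least element, which can be chosen. *)
Lemma compact_meets_few_blocks C : compact_in X T C ->
  exists m, N m /\ forall n z, N n -> m < n -> block n z -> ~ mem (v z) C.
Proof.
move=> hC; apply: contrapT => no; apply: no_choice.
have dB := definable_block.
pose H n z := block n z /\ mem (v z) C /\ forall y, block n y -> mem (v y) C -> z <= y.
apply: (@partial_choice H).
- by unfold H; defn.
- move=> n z z' [Bz [Cz hz]] [Bz' [Cz' hz']].
  by apply/eqP; rewrite eq_le hz // hz'.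
- move=> n Nn; apply: contrapT => none; apply: no; exists n; split=> // m z Nm nm Bz Cz.
  have [||||||y [[By Cy] Oy]] := @compact_chain _ hTR X T hX hT C
    (fun y => block m y /\ mem (v y) C)
    (fun y x => x < weight m \/ weight m * (5 / 2) < x \/ y < x) hC.
  + by exists (v z).
  + by defn.
  + by defn.
  + move=> y _ x [h|[h|h]].
    * by exists (x - 1), (weight m); split; [lra|split=> // w _ hw; left].
    * exists (weight m * (5 / 2)), (x + 1); split=> //; split; first by lra.
      by move=> w hw _; right; left.
    * exists y, (x + 1); split=> //; split; first by lra.
      by move=> w hw _; right; right.
  + move=> y y' x _ _ yy' [h|[h|h]]; [by left|by right; left|right; right].
    exact: le_lt_trans yy' h.
  + move=> x Cx; have [Bx|nBx] := pselect (block m x); last first.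
      have [h|h] := block_gap Nm (proj1 hC _ Cx) nBx.
      * by exists z; split=> //; left.
      * by exists z; split=> //; right; left.
    have [y [By [Cy yx]]] : exists y, block m y /\ mem (v y) C /\ y < x.
      apply: contrapT => noy; apply: none; exists m, x; split=> //; split=> //.
      split=> //; split=> //; split=> // y By Cy; rewrite leNgt; apply/negP => yx.
      by apply: noy; exists y.
    by exists y; split=> //; right; right.
  have [h1 h2] := block_bounds Nm By.
  by case: (Oy y Cy) => [h|[h|h]]; lra.
Qed.

Lemma compact_closed C : compact_in X T C -> forall x, mem (v x) X -> ~ mem (v x) C ->
  exists a b, a < x /\ x < b /\ forall y, a < y -> y < b -> ~ mem (v y) C.
Proof.
move=> hC x Xx nCx; have [Cne|Cempty] := pselect (nonempty C); last first.
  exists (x - 1), (x + 1); split; first by lra.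
  by split; [lra|move=> y _ _ Cy; apply: Cempty; exists (v y)].
have [|||||eps [he heps]] := @compact_chain _ hTR X T hX hT C (fun eps => 0 < eps)
  (fun eps y => y < x - eps \/ x + eps < y) hC Cne.
- by defn.
- by defn.
- move=> eps _ y [h|h].
  + by exists (y - 1), (x - eps); split; [lra|split=> // w _ hw; left].
  + by exists (x + eps), (y + 1); split=> //; split; [lra|move=> w hw _; right].
- by move=> e e' y _ _ ee' [h|h]; [left; lra|right; lra].
- move=> y Cy; have [yx|xy|E] := ltgtP y x; last by case: nCx; rewrite -E.
  + by exists ((x - y) / 2); split; [lra|left; lra].
  + by exists ((y - x) / 2); split; [lra|right; lra].
exists (x - eps), (x + eps); split; first by lra.
by split; [lra|move=> y h1 h2 /heps [h|h]; lra].
Qed.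

(** The subset without 0 is not closed, but its traces on compact sets are. *)
Lemma space_not_k : ~ k_space X T.
Proof.
move=> [_ kX].
have [|P [PR hP]] := @real_set_ex (fun z => mem (v z) X /\ z <> 0); first by defn.
have PX : subset P X.
  by move=> x hx; have [y ?] := val_surj hK (PR x hx); subst x; have /hP [] := hx.
have X0 : mem (v 0) X by apply/XE; left.
suff : closed_in X T P.
  move=> /(closed_inP hTR hX hT PX) /(_ 0 X0) [|a [b [a0 [b0 h]]]].
    by move=> /hP [_]; apply.
  have [m [Nm [_ hm]]] := block_small 0 b0.
  have [z hz] := block_nonempty Nm; have [_ h1] := block_bounds Nm hz.
  have z0 := block_gt0 Nm hz.
  apply: (h z); [lra|lra|apply/hP; split; first exact: space_block hz].
  by move=> E; lra.
apply: kX => // C I hC hI.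
have IX : subset I X by move=> x /hI [/PX].
apply/(closed_inP hTR hX hT IX) => x Xx nIx.
have [x0|nx0] := pselect (x = 0).
- subst x; have [m [Nm hm]] := compact_meets_few_blocks hC.
  have w0 := weight_gt0 Nm.
  exists (-1), (weight m); split; first by lra.
  split=> // y _ ym /hI [/hP [/XE [//|[n [Nn hy]]] _] Cy].
  have [mn|nm] := ltP m n; first exact: hm hy Cy.
  have [h1 _] := block_bounds Nn hy.
  move: nm; rewrite le_eqVlt => /orP[/eqP E|/(weight_lt Nn Nm)]; last by lra.
  by rewrite E in h1; lra.
- have [|a [b [ax [xb h]]]] := compact_closed hC Xx.
    by move=> Cx; apply: nIx; apply/hI; split=> //; apply/hP.
  by exists a, b; split=> //; split=> // y ay yb /hI [_]; apply: h.
Qed.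

Lemma labelled_first_blocks : (forall i, N i -> labelled (A i)) -> forall n, N n ->
  labelled (fun x => x = 0 \/ exists i, N i /\ i < n /\ block i x).
Proof.
move=> hA; have dB := definable_block.
apply: nat_ind => [||n Nn IH]; first by unfold labelled; defn.
- apply: labelled_unique => x y [->|[i [Ni [h _]]]]; last by have := nat_ge0 Ni; lra.
  by move=> [->|[i [Ni [h _]]]] //; have := nat_ge0 Ni; lra.
- apply: labelled_sub (labelled_or _ _ IH (labelled_block hA Nn)); [|by defn|by defn].
  move=> x [->|[i [Ni [/(nat_ltS Ni Nn)]]]]; first by left; left.
  rewrite le_eqVlt => /orP[/eqP ->|h] Bx; first by right.
  by left; right; exists i.
Qed.

Lemma uncountable_infinite_closed U : (forall i, N i -> labelled (A i)) ->
  subset U X -> uncountable U ->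
  exists C, subset C U /\ infinite C /\ closed_in X T C.
Proof.
move=> hA UX hU; apply: contrapT => noC.
have dB := definable_block.
(* [H n z]: [z] is the infimum of the intersection of [U] with [block n]. *)
pose S n y := block n y /\ mem (v y) U.
pose H n z := (exists y, S n y) /\ (forall y, S n y -> z <= y) /\
  forall c, (forall y, S n y -> c <= y) -> c <= z.
have meets n y : N n -> S n y -> exists z, H n z /\ block n z.
  move=> Nn Sy.
  have dS : definableR (S n) by unfold S; defn.
  have [||z [lb glb]] := real_inf dS; first by exists y.
    by exists (weight n) => x [/(block_bounds Nn) []].
  exists z; split; first by split; [exists y|].
  apply: contrapT => nBz; apply: noC.
  have [||||C [CS [Cinf Ccl]]] := @infinite_closed_ex _ hTR X T hX hT (S n) z dS _ _ _ lb glb.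
  - by apply: labelled_sub (labelled_block hA Nn) => x [].
  - by exists y.
  - by move=> x [Bx _]; apply: space_block Bx.
  - move=> Xz; have [h|h] := block_gap Nn Xz nBz.
    + suff : weight n <= z by lra.
      by apply: glb => x [/(block_bounds Nn) []].
    + by have := lb y Sy; have [_] := block_bounds Nn (proj1 Sy); lra.
  exists C; split=> // x /CS [xR [_ hx]].
  by rewrite val_real_of in hx.
have [[m [Nm hm]]|unb] := pselect (exists m, N m /\ forall n y, N n -> m < n -> ~ S n y).
- apply: hU; apply: labelled_countable; first by move=> x /UX /hX.
  apply: labelled_sub (labelled_first_blocks hA (natS Nm)) => x Ux.
  have /XE [->|[n [Nn Bx]]] := UX _ Ux; [by left|right].
  exists n; split=> //; split=> //; rewrite ltNge; apply/negP => h.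
  by apply: (hm n x) => //; lra.
- apply: no_choice; apply: (@partial_choice H).
  + by unfold H, S; defn.
  + move=> n z z' [_ [l g]] [_ [l' g']].
    by apply/eqP; rewrite eq_le g' // g.
  + move=> n Nn; apply: contrapT => no; apply: unb; exists n; split=> // m y Nm nm Sy.
    by have [z [Hz Bz]] := meets m y Nm Sy; apply: no; exists m, z.
Qed.

End Space.

End Family.

(** A countable family of non-empty sets of reals without choice function,
    reindexed by all the natural numbers; the missing indices get the set
    whose only element is 0. *)
Lemma family_ex F : countable F -> (forall a, mem a F -> subset a R /\ nonempty a) ->
  ~ has_choice_function F ->
  exists A : K -> K -> Prop, [/\ definableRR A, (forall i, N i -> exists y, A i y),
    ~ (exists f, real_sequence f /\ forall i, N i -> A i (value f i)) &
    (forall a, mem a F -> countable a) -> forall i, N i -> labelled (A i)].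
Proof.
move=> hF hFR nochoice; have [j [hj jinj]] := countable_injection hF.
pose A i y := (exists a, Defs.rel j a (v i) /\ mem (v y) a) \/
  ((~ exists a, Defs.rel j a (v i)) /\ y = 0).
have Aa a i y : Defs.rel j a (v i) -> A i y -> mem (v y) a.
  move=> hai [[b [hbi hy]]|[no _]]; last by case: no; exists a.
  by rewrite (jinj _ _ _ hai hbi).
exists A; split.
- by unfold A; defn.
- move=> i Ni; have [[a ha]|no] := pselect (exists a, Defs.rel j a (v i)); last first.
    by exists 0; right.
  have [aF _] := rel_dom_cod hj ha; have [aR [x hx]] := hFR a aF.
  have [y ?] := val_surj hK (aR x hx); subst x.
  by exists y; left; exists a.
- move=> [f [hf hfA]]; apply: nochoice.
  have [||phi [hphi hr]] := @function_ex _ _ F R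
    (fun a y => exists i, N i /\ Defs.rel j a (v i) /\ y = v (value f i)).
  + by defn.
  + move=> a aF; have [x [hx haj]] := rel_ex hj aF; have [i [Ni ?]] := naturals_val hx; subst x.
    exists (v (value f i)); split; first by split; [apply: (val_mem hK)|exists i].
    move=> y [_ [i' [Ni' [haj' ->]]]].
    by rewrite (val_inj hK (rel_uniq hj haj haj')).
  exists phi, R; split=> // a y _ /hr [_ [_ [i [Ni [hai ->]]]]].
  by apply: Aa hai _; apply: hfA.
- move=> hc i Ni; have [[a ha]|no] := pselect (exists a, Defs.rel j a (v i)); last first.
    apply: labelled_unique => x y [[a [ha _]]|[_ ->]]; first by case: no; exists a.
    by move=> [[a [ha _]]|[_ ->]] //; case: no; exists a.
  have [aF _] := rel_dom_cod hj ha; have [aR _] := hFR a aF.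
  by apply: labelled_sub (countable_labelled aR (hc a aF)) => y; apply: Aa ha.
Qed.

(** The counterexample space attached to a family without choice function. *)
Lemma space_ex TR F : is_standard_topology R lt TR -> countable F ->
  (forall a, mem a F -> subset a R /\ nonempty a) -> ~ has_choice_function F ->
  exists X T, [/\ subset X R, is_subspace_topology TR X T, ~ k_space X T, ~ loeb X T &
    (forall a, mem a F -> countable a) ->
    forall U, subset U X -> uncountable U ->
      exists C, subset C U /\ infinite C /\ closed_in X T C].
Proof.
move=> hTR hF hFR nochoice.
have [A [dA Ane noA hcount]] := family_ex hF hFR nochoice.
have dB := definable_block dA.
have [|X [XR XE]] := @real_set_ex (fun z => z = 0 \/ exists n, N n /\ block A n z).
  by defn.
have [T hT] := subspace_topology_ex TR X.
exists X, T; split=> //.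
- exact: (space_not_k dA Ane hTR XR hT XE noA).
- exact: (space_not_loeb dA Ane hTR XR hT XE noA).
- move=> hc U UX hU.
  exact: (uncountable_infinite_closed dA hTR XR hT XE noA (hcount hc) UX hU).
Qed.

End Analysis.

Theorem theorem6p8 (V : set_structure) (hV : ZF V)
  (R zero one add mul lt TR : V)
  (hR : is_reals R zero one add mul lt)
  (hTR : is_standard_topology R lt TR) :
  (~ CAC_omega R ->
     exists X T : V,
       subset X R /\ is_subspace_topology TR X T /\
       ~ k_space X T /\ ~ loeb X T /\
       (forall U : V, subset U X -> uncountable U ->
          exists C : V, subset C U /\ infinite C /\ closed_in X T C))
  /\
  ((forall X T : V, subset X R -> is_subspace_topology TR X T ->
      k_space X T \/ loeb X T) ->
   CAC R).
Proof.
have [K [v hK]] := reals_model_ex hV hR.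
split.
- move=> noCAC.
  have [F [[Fc _] [hF nochoice]]] : exists F, denumerable F /\
      (forall a, mem a F -> subset a R /\ nonempty a /\ countable a) /\
      ~ has_choice_function F.
    apply: contrapT => no; apply: noCAC => F Fd hF; apply: contrapT => nc.
    by apply: no; exists F.
  have [|X [T [h1 h2 h3 h4 h5]]] := space_ex hR hK hTR Fc _ nochoice.
    by move=> a /hF [h1 [h2 _]].
  exists X, T; do 4!split=> //.
  by apply: h5 => a /hF [_ [_]].
- move=> hyp F [Fc _] hF; apply: contrapT => nochoice.
  have [X [T [h1 h2 h3 h4 _]]] := space_ex hR hK hTR Fc hF nochoice.
  by case: (hyp X T h1 h2).
Qed.
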